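(* Let $r\ge 1$, let $m_1,\ldots,m_r$ be positive integers and put $m:=m_1+\cdots+m_r$. Let $a,c,d_1,\ldots,d_r$ be complex numbers such that none of $c,d_1,\ldots,d_r$ is in $\{0,-1,-2,\ldots\}$. Then, provided $\mathrm{Re}(c-a)>m$, we have $$\sum_{k=1}^\infty \frac{(a)_k\,(d_1+m_1)_k\cdots(d_r+m_r)_k}{(c)_k\,(d_1)_k\cdots(d_r)_k\;k}=\psi(c)-\psi(c-a)+\sum_{k=1}^m \frac{(-1)^k (a)_k\, \Gamma(k)\, C_{k,r}}{(1+a-c)_k},$$ where the coefficients $C_{k,r}$ $(0\le k\le m)$ are defined by $$C_{k,r}=\frac{1}{\Lambda}\sum_{j=k}^m \sigma_j\,\mathbf{S}_j^{(k)},\qquad \Lambda=(d_1)_{m_1}\cdots(d_r)_{m_r},$$ with $\mathbf{S}_j^{(k)}$ the Stirling numbers of the second kind and $\sigma_0,\ldots,\sigma_m$ the coefficients determined by the polynomial identity $$(d_1+x)_{m_1}\cdots(d_r+x)_{m_r}=\sum_{j=0}^m\sigma_j x^j.$$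
   Context: $(x)_k$ denotes the Pochhammer symbol $(x)_k=x(x+1)\cdots(x+k-1)$ for $k\ge1$, with $(x)_0=1$. $\psi(x)=\Gamma'(x)/\Gamma(x)$ is the logarithmic derivative of the gamma function. The Stirling number of the second kind $\mathbf{S}_j^{(k)}$ is the number of partitions of a $j$-element set into $k$ nonempty blocks (with $\mathbf{S}_0^{(0)}=1$). The coefficients can equivalently be written as the terminating hypergeometric sum $$C_{k,r}=\frac{(-1)^k}{k!}\sum_{j=0}^k\frac{(-k)_j}{j!}\prod_{i=1}^r\frac{(d_i+m_i)_j}{(d_i)_j}.$$ *)

(* Defs.v *)
From mathcomp Require Import all_boot all_order all_algebra.
From mathcomp Require Import all_classical all_reals all_analysis.
From mathcomp.real_closed Require Export complex.
Import Order.TTheory GRing.Theory Num.Theory.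
Import numFieldNormedType.Exports.

Set Implicit Arguments.
Unset Strict Implicit.
Unset Printing Implicit Defensive.

Local Open Scope classical_set_scope.
Local Open Scope ring_scope.

(* Stated over an arbitrary ring, so that the same symbol applies both to
   complex numbers and to polynomials. *)
Definition poch (S : pzRingType) (x : S) (k : nat) : S :=
  \prod_(i < k) (x + i%:R).

Definition stirling2 (j k : nat) : nat :=
  #|[set P : {set {set 'I_j}} | finset.partition P [set: 'I_j] & #|P| == k]|.

Section Gamma.
Variable R : realType.

Definition cexp (z : R[i]) : R[i] :=
  (expR (complex.Re z))%:C%C
  * ((cos (complex.Im z))%:C%C + 'i%C * (sin (complex.Im z))%:C%C).

(* n ^ z with the principal logarithm; only meaningful for 0 < n. *)
Definition cnatpow (n : nat) (z : R[i]) : R[i] :=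
  cexp (z * (ln (n%:R : R))%:C%C).

(* R[i] carries no topology by itself: wherever one is needed, the regular
   module R[i]^o over the numFieldType R[i] is used, i.e. the topology of the
   complex modulus.

   Euler's limit  Gamma(z) = lim_n n! n^(z-1) / (z)_n,  which defines Gamma at
   every complex z outside {0, -1, -2, ...} (junk value at the poles). *)
Definition Gamma (z : R[i]) : R[i] :=
  lim ((n`!%:R * cnatpow n (z - 1) / poch z n : R[i]^o) @[n --> \oo]).

(* derive1 is taken over the base field R[i]: this is the complex derivative. *)
Definition psi (z : R[i]) : R[i] :=
  derive1 (Gamma : R[i] -> R[i]^o) z / Gamma z.

End Gamma.

Section Coefficients.
Variables (R : realType) (r : nat) (m : 'I_r -> nat) (d : 'I_r -> R[i]).

Definition mtot : nat := (\sum_(i < r) m i)%N.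

(* The coefficients of (d_1 + X)_{m_1} ... (d_r + X)_{m_r}, a polynomial of
   degree mtot in X. *)
Definition sigma (j : nat) : R[i] :=
  (\prod_(i < r) poch ((d i)%:P + 'X) (m i))`_j.

Definition Lambda : R[i] := \prod_(i < r) poch (d i) (m i).

Definition Ccoef (k : nat) : R[i] :=
  Lambda^-1 * \sum_(k <= j < mtot.+1) sigma j * (stirling2 j k)%:R.

End Coefficients.

(* Main.v *)
Require Import Defs.
From mathcomp Require Import all_boot all_order all_algebra.
From mathcomp Require Import all_classical all_reals all_analysis.
From mathcomp.real_closed Require Import complex.
From mathcomp Require Import ring lra.
Import Order.TTheory GRing.Theory Num.Theory.
Import numFieldNormedType.Exports.
Local Open Scope classical_set_scope.
Local Open Scope ring_scope.
Import ComplexField.Normc.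

Set Implicit Arguments.
Unset Strict Implicit.
Unset Printing Implicit Defensive.

(** Since (d)_k (d + k)_m = (d)_(k+m) = (d)_m (d + m)_k, the parameters d_i
    enter the k-th term of the series only through the polynomial value
    prod_i (d_i + k)_(m_i), divided by its value Lambda at k = 0.  Expanding
    the powers of k in falling factorials k^_l, with Stirling numbers as
    coefficients, turns this quotient into sum_l C_l k^_l ([Ccoef_ffact]), and
    C_0 = 1 because only l = 0 survives at k = 0.  Dividing by k splits the
    series into one logarithmic series, the sum of (a)_k / ((c)_k k), and m
    series with terms (a)_k / (c)_k (k-1)^_(l-1), one for each l >= 1.

    The latter are summed by telescoping: the increment in j of the product
    (a)_(j+1) / (c)_j j^_e only involves j^_e and j^_(e-1)
    ([telescope_poch_ffact]), and the boundary term tends to 0 as long as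
    Re (c - a) > e + 1.  The resulting recursion in e gives the closed form of
    [ctends_sum_poch_ffact], a case of Gauss's summation theorem.

    Write F(c) for the logarithmic series.  The factor k cancels in
    F(c) - F(c+1), which is therefore again a telescoping sum, with value
    1/(c-a) - 1/c.  As F(c+N) tends to 0, F(c) is the sum over j of
    1/(c-a+j) - 1/(c+j), and it remains to recognise psi(c) - psi(c-a).

    For that, let G_n be Euler's sequence with limit Gamma.  The quotient
    G_n(z+h) / G_n(z) is a product of n factors of the form
    1 + h v_k + O(|h|^2 / k^2), where v_k = ln ((k+1)/k) - 1/(z+k) is itself
    O(1 / k^2).  Estimates for such products that do not depend on n give at
    once the convergence of G_n (take z = 1, where G_n is constant), the fact
    that Gamma does not vanish (exchange the two points), and the expansion
    Gamma(z+h) / Gamma(z) = 1 + h sum_k v_k + O(|h|^2), so that psi(z) is the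
    sum of the v_k ([ctends_psi]).  No general theorem on holomorphic
    functions is involved. *)

(** * Modulus and convergence of complex numbers *)

Section ComplexModulus.
Variable R : realType.
Implicit Types (z w : R[i]).

Lemma normr_normc z : `|z| = (normc z)%:C%C.
Proof. by case: z. Qed.
Lemma normc_ge0 z : 0 <= normc z.
Proof. by rewrite -ler0c -normr_normc normr_ge0. Qed.
Lemma normcD z w : normc (z + w) <= normc z + normc w.
Proof. by have := ler_normD z w; rewrite !normr_normc -rmorphD lecR. Qed.
Lemma normcN z : normc (- z) = normc z.
Proof. by have := normrN z; rewrite !normr_normc => -[]. Qed.
Lemma normcB z w : normc (z - w) <= normc z + normc w.
Proof. by rewrite -(normcN w) normcD. Qed.
Lemma normc_real (x : R) : normc x%:C%C = `|x|.
Proof. by rewrite /normc /= expr0n addr0 sqrtr_sqr. Qed.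
Lemma normc_nat n : normc (n%:R : R[i]) = n%:R.
Proof. by rewrite -(rmorph_nat (real_complex R)) normc_real normr_nat. Qed.
Lemma normc_i : normc ('i%C : R[i]) = 1.
Proof. by rewrite /normc /= expr0n add0r expr1n sqrtr1. Qed.
Lemma normc_eq0 z : (normc z == 0) = (z == 0).
Proof.
by apply/eqP/eqP => [|->]; [exact: eq0_normc | rewrite normc0].
Qed.
Lemma normc_gt0 z : (0 < normc z) = (z != 0).
Proof. by rewrite lt_def normc_ge0 andbT normc_eq0. Qed.
Lemma ReD z w : complex.Re (z + w) = complex.Re z + complex.Re w.
Proof. by case: z w => [? ?] [? ?]. Qed.
Lemma ReN z : complex.Re (- z) = - complex.Re z.
Proof. by case: z. Qed.
Lemma Re_nat n : complex.Re (n%:R : R[i]) = n%:R.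
Proof. by rewrite -(rmorph_nat (real_complex R)). Qed.
Lemma Re_le_normc z : complex.Re z <= normc z.
Proof. by apply: le_trans (ler_norm _) _; rewrite -lecR; apply: normc_ge_Re. Qed.
Lemma ler_normc_sum n (x : nat -> R[i]) :
  normc (\sum_(k < n) x k) <= \sum_(k < n) normc (x k).
Proof.
elim: n => [|n IH]; first by rewrite !big_ord0 normc0.
by rewrite !big_ord_recr /=; apply: le_trans (normcD _ _) _; rewrite lerD2r.
Qed.

(** Convergence in modulus.  All ring operations inside [u] and [l] are those
    of [R[i]]; the regular module [R[i]^o], which carries the topology, has
    its own copies of them, and [ctendsP] is the only passage between the two. *)
Definition ctends (T : Type) (F : set_system T) (u : T -> R[i]) (l : R[i]) : Prop :=
  normc (u x - l) @[x --> F] --> (0 : R).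

Lemma ctendsP {T : Type} {F : set_system T} {FF : Filter F} (u : T -> R[i]) (l : R[i]) :
  ctends F u l <-> ((u x : R[i]^o) @[x --> F] --> (l : R[i]^o)).
Proof.
split => /cvgrPdist_lt h; apply/cvgrPdist_lt => e e0; last first.
  have := h e%:C%C; rewrite ltcR => /(_ e0); apply: filterS => x.
  by rewrite normr_normc ltcR sub0r normrN ger0_norm ?normc_ge0 // -normcN opprB.
(* A positive radius in [R[i]] is a positive real number. *)
have [ie re] : complex.Im e = 0 /\ 0 < complex.Re e.
  by move: e0; rewrite ltcE /= => /andP[/eqP -> ->].
have eE : e = (complex.Re e)%:C%C by case: e ie {re e0} => a b /= ->.
apply: filterS (h _ re) => x; rewrite sub0r normrN ger0_norm ?normc_ge0 // => hx.
by rewrite normr_normc -normcN opprB eE ltcR.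
Qed.

Section Ctends.
Context {T : Type} {F : set_system T} {FF : ProperFilter F}.
Implicit Types (u v : T -> R[i]) (l k : R[i]).

Lemma ctends_squeeze u l (g : T -> R) :
  (\forall x \near F, normc (u x - l) <= g x) -> g x @[x --> F] --> (0 : R) ->
  ctends F u l.
Proof.
move=> h hg; apply: (@squeeze_cvgr _ _ _ _ (fun=> 0) g) => //; last exact: cvg_cst.
by apply: filterS h => x hx; rewrite normc_ge0.
Qed.

Lemma ctends_near u v l : (\forall x \near F, u x = v x) -> ctends F u l -> ctends F v l.
Proof.
move=> h hu; apply: (ctends_squeeze (g := fun x => normc (u x - l))) => //.
by apply: filterS h => x ->.
Qed.

Lemma ctends_ext u v l : (forall x, u x = v x) -> ctends F u l -> ctends F v l.
Proof. by move=> h; apply: ctends_near; apply: nearW. Qed.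

Lemma ctends_cst l : ctends F (fun=> l) l.
Proof. by apply/ctendsP; apply: cvg_cst. Qed.
Lemma ctends_normc u l : ctends F u l -> normc (u x) @[x --> F] --> normc l.
Proof.
move=> h; apply/cvgrPdist_lt => e e0.
move/cvgrPdist_lt: h => /(_ e e0); apply: filterS => n.
rewrite sub0r normrN ger0_norm ?normc_ge0 //; apply: le_lt_trans.
rewrite ler_norml; have := normcD (u n - l) l; have := normcD (l - u n) (u n).
rewrite !subrK -(normcN (l - u n)) opprB; lra.
Qed.

Lemma ctendsN u l : ctends F u l -> ctends F (fun x => - u x) (- l).
Proof.
move=> h; apply: (ctends_squeeze (g := fun x => normc (u x - l))) => //.
by apply: nearW => x; rewrite -opprD normcN.
Qed.

Lemma ctendsD u v l k : ctends F u l -> ctends F v k -> ctends F (fun x => u x + v x) (l + k).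
Proof.
move=> hu hv; apply: (ctends_squeeze (g := fun x => normc (u x - l) + normc (v x - k))).
  by apply: nearW => x; rewrite opprD addrACA normcD.
by rewrite -[0 : R]addr0; apply: cvgD.
Qed.

Lemma ctendsB u v l k : ctends F u l -> ctends F v k -> ctends F (fun x => u x - v x) (l - k).
Proof. by move=> /ctendsD h1 /ctendsN /h1. Qed.

Lemma ctendsM u v l k : ctends F u l -> ctends F v k -> ctends F (fun x => u x * v x) (l * k).
Proof.
move=> hu hv.
apply: (ctends_squeeze (g := fun x => normc (u x - l) * normc (v x) + normc l * normc (v x - k))).
  apply: nearW => x; have -> : u x * v x - l * k = (u x - l) * v x + l * (v x - k) by ring.
  by apply: le_trans (normcD _ _) _; rewrite !normcM.
rewrite -[0 : R]addr0; apply: cvgD.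
  by rewrite -(mul0r (normc k)); apply: cvgM => //; apply: ctends_normc.
by rewrite -(mulr0 (normc l)); apply: cvgMr.
Qed.

Lemma ctendsV u l : l != 0 -> ctends F u l -> ctends F (fun x => (u x)^-1) l^-1.
Proof.
move=> l0 hu; have nu := ctends_normc hu.
have nl0 : normc l != 0 by rewrite normc_eq0.
apply: (ctends_squeeze (g := fun x => normc (u x - l) * ((normc (u x))^-1 * (normc l)^-1))).
  near=> x.
  have u0 : u x != 0 by rewrite -normc_eq0; near: x; apply: (cvgr_neq0 _ nu).
  have -> : (u x)^-1 - l^-1 = - ((u x - l) * ((u x)^-1 * l^-1)) by field; rewrite u0 l0.
  by rewrite normcN !normcM !normcV.
rewrite -(mul0r ((normc l)^-1 * (normc l)^-1)); apply: cvgM => //.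
by apply: cvgM; [exact: cvgV | exact: cvg_cst].
Unshelve. all: by end_near.
Qed.

Lemma ctends_unique u l k : ctends F u l -> ctends F u k -> l = k.
Proof.
by move=> /ctendsP h1 /ctendsP h2; apply: (cvg_unique _ h1 h2); apply: norm_hausdorff.
Qed.

Lemma ctends_lim u l : ctends F u l -> lim ((u x : R[i]^o) @[x --> F]) = l.
Proof. by move=> /ctendsP; apply: cvg_lim; apply: norm_hausdorff. Qed.

Lemma ctends_normc_le u l (B : R) : ctends F u l ->
  (forall x, normc (u x) <= B) -> normc l <= B.
Proof.
move=> /ctends_normc h hB; rewrite -(cvg_lim _ h) //; apply: limr_le; first by apply/cvg_ex;
  eexists; exact: h.
by apply: nearW.
Qed.
End Ctends.

Lemma ctends_sum {T : Type} {F : set_system T} {FF : ProperFilter F} n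
    (u : nat -> T -> R[i]) (l : nat -> R[i]) :
  (forall i, (i < n)%N -> ctends F (u i) (l i)) ->
  ctends F (fun x => \sum_(i < n) u i x) (\sum_(i < n) l i).
Proof.
elim: n => [|n IH] h.
  rewrite big_ord0; apply: ctends_ext (ctends_cst 0) => x; by rewrite big_ord0.
rewrite big_ord_recr /=; apply: ctends_ext (ctendsD (IH _) (h n _)) => // [x|i hi].
  by rewrite big_ord_recr.
by apply: h; apply: ltnW.
Qed.
End ComplexModulus.

(** * Second-order estimate for the complex exponential *)

Section ComplexExponential.
Variable R : realType.
Implicit Types (z w : R[i]).

Lemma cexpD z w : cexp (z + w) = cexp z * cexp w.
Proof.
case: z w => [a b] [c e]; rewrite /cexp /= expRD cosD sinD.
by apply/eqP; rewrite eq_complex /=; apply/andP; split; apply/eqP; ring.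
Qed.

Lemma cexp0 : cexp 0 = 1 :> R[i].
Proof. by rewrite /cexp /= expR0 cos0 sin0 mulr0 addr0 mulr1. Qed.

Lemma cexp_neq0 z : cexp z != 0.
Proof.
apply/eqP => h; have := cexpD z (- z).
by rewrite subrr cexp0 h mul0r => /eqP; rewrite oner_eq0.
Qed.

Lemma normc_cis (y : R) : normc ((cos y)%:C%C + 'i%C * (sin y)%:C%C : R[i]) = 1.
Proof.
rewrite /normc /= !mul0r !mul1r !subr0 !addr0 !add0r.
by rewrite cos2Dsin2 sqrtr1.
Qed.

Lemma normc_cexp z : normc (cexp z) = expR (complex.Re z).
Proof.
by rewrite /cexp normcM normc_cis mulr1 normc_real ger0_norm ?expR_ge0.
Qed.

Lemma MVT_at0 (f df : R -> R) (x : R) : (forall x : R, is_derive x (1 : R) f (df x)) ->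
  exists2 c, `|c| <= `|x| & f x - f 0 = df c * x.
Proof.
move=> hf; have fc a b : {within `[a, b], continuous f}.
  apply: continuous_subspaceT => y; apply/differentiable_continuous/derivable1_diffP.
  by have := hf y => -[].
case: (leP 0 x) => x0.
  have [c] := @MVT_segment R f df 0 x x0 (fun y _ => hf y) (fc _ _).
  rewrite in_itv /= subr0 => /andP[c0 cx] e; exists c => //.
  by rewrite !ger0_norm // (le_trans c0).
have [c] := @MVT_segment R f df x 0 (ltW x0) (fun y _ => hf y) (fc _ _).
rewrite in_itv /= => /andP[c0 cx] e; exists c; first by rewrite !ler0_norm ?lerN2 // ltW.
by apply: oppr_inj; rewrite opprB e sub0r mulrN.
Qed.

Lemma abs_sin_le (y : R) : `|sin y| <= `|y|.
Proof.
have [c _] := MVT_at0 y (@is_derive_sin R); rewrite sin0 subr0 => ->.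
by rewrite normrM ler_piMl // cos_max.
Qed.

(** The factor 1 gives the linear bound behind [sin_subx_le], the factor
    |y| the quadratic one behind [cexp_sub1x_le]. *)
Lemma cos_sub1_le (y : R) : `|cos y - 1| <= `|y| * Num.min 1 `|y|.
Proof.
have [c cy] := MVT_at0 y (@is_derive_cos R); rewrite cos0 => ->.
rewrite normrM normrN mulrC ler_wpM2l // le_min sin_max /=.
exact: le_trans (abs_sin_le _) cy.
Qed.

Lemma sin_subx_le (y : R) : `|sin y - y| <= y ^+ 2.
Proof.
have [c cy] := MVT_at0 y (fun x => is_deriveB (is_derive_sin x) (is_derive_id x 1)).
rewrite !fctE /= sin0 !subr0 => ->; rewrite normrM -real_normK ?num_real // expr2 ler_wpM2r //.
apply: le_trans (cos_sub1_le c) _.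
by apply: le_trans cy; rewrite ler_piMr // ge_min lexx.
Qed.

Lemma expR_sub1_le (x : R) : `|expR x - 1| <= expR `|x| * `|x|.
Proof.
have [c cx] := MVT_at0 x (@is_derive_expR R); rewrite expR0 => ->.
rewrite normrM ler_wpM2r // ger0_norm ?expR_ge0 // ler_expR.
by apply: le_trans cx; rewrite ler_norm.
Qed.

Lemma expR_sub1x_le (x : R) : `|expR x - 1 - x| <= expR `|x| * x ^+ 2.
Proof.
have [c cx] := MVT_at0 x (fun x => is_deriveB (is_derive_expR x) (is_derive_id x 1)).
rewrite !fctE /= expR0 !subr0 => h.
have -> : expR x - 1 - x = (expR c - 1) * x by rewrite -h; ring.
rewrite normrM -(@real_normK _ x) ?num_real // expr2 mulrA ler_wpM2r //.
apply: le_trans (expR_sub1_le c) _.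
by rewrite ler_pM ?expR_ge0 // ler_expR.
Qed.

Lemma normc_complex (a b : R) : normc (a%:C%C + 'i%C * b%:C%C : R[i]) <= `|a| + `|b|.
Proof.
apply: le_trans (normcD _ _) _.
by rewrite normcM normc_i mul1r !normc_real.
Qed.

Lemma Im_le_normc z : `|complex.Im z| <= normc z.
Proof.
rewrite -[complex.Im z]opprK -ReiNIm normrN; apply: le_trans (_ : normc (z * 'i%C) <= _).
  by rewrite -lecR; apply: normc_ge_Re.
by rewrite normcM normc_i mulr1.
Qed.
Lemma absRe_le_normc z : `|complex.Re z| <= normc z.
Proof. by rewrite -lecR; apply: normc_ge_Re. Qed.

(** With z = x + iy, the remainder splits as
    (e^x - 1 - x) e^(iy) + (1 + x) (e^(iy) - 1 - iy) + ixy,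
    which leaves real estimates only. *)
Lemma cexp_sub1x_le z : normc (cexp z - 1 - z) <= 
  (expR (normc z) + (1 + normc z) * 2 + 1) * normc z ^+ 2.
Proof.
set x := complex.Re z; set y := complex.Im z; set N := normc z.
have hx : `|x| <= N := absRe_le_normc z.
have hy : `|y| <= N := Im_le_normc z.
have N0 : 0 <= N by apply: normc_ge0.
pose E : R[i] := (cos y)%:C%C + 'i%C * (sin y)%:C%C.
have -> : cexp z - 1 - z = (expR x - 1 - x)%:C%C * E
    + ((1 + x)%:C%C * ((cos y - 1)%:C%C + 'i%C * (sin y - y)%:C%C) + 'i%C * (x * y)%:C%C).
  rewrite /cexp /E /x /y; case: (z) => a b /=.
  by apply/eqP; rewrite eq_complex /=; apply/andP; split; apply/eqP; ring.
have x2 : x ^+ 2 <= N ^+ 2 by rewrite -real_normK ?num_real // lerXn2r ?nnegrE.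
have y2 : y ^+ 2 <= N ^+ 2 by rewrite -real_normK ?num_real // lerXn2r ?nnegrE.
have -> : (expR N + (1 + N) * 2 + 1) * N ^+ 2
  = expR N * N ^+ 2 + ((1 + N) * (2 * N ^+ 2) + N * N).
  by ring.
apply: le_trans (normcD _ _) _; apply: lerD.
  rewrite normcM normc_cis mulr1 normc_real.
  apply: le_trans (expR_sub1x_le x) _.
  by rewrite ler_pM ?expR_ge0 ?sqr_ge0 // ler_expR.
apply: le_trans (normcD _ _) _; apply: lerD.
  rewrite normcM normc_real ler_pM ?normc_ge0 //.
    by apply: le_trans (ler_normD _ _) _; rewrite normr1 lerD2l.
  apply: le_trans (normc_complex _ _) _.
  have h1 := sin_subx_le y.
  have h2 := cos_sub1_le y.
  have h3 : `|y| * Num.min 1 `|y| <= N ^+ 2.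
    by rewrite expr2 ler_pM // ?le_min ?ler01 //= ge_min hy orbT.
  lra.
rewrite normcM normc_i mul1r normc_real normrM.
by rewrite ler_pM.
Qed.
End ComplexExponential.

(** * Infinite products close to 1 *)

Section Products.
Variable R : realType.
Implicit Types (z w : R[i]).

(** A stand-in for 1/k^2 that telescopes. *)
Definition inv_pronic (k : nat) : R := (k.+1%:R * k.+2%:R)^-1.

Lemma inv_pronicE k : inv_pronic k = k.+1%:R^-1 - k.+2%:R^-1.
Proof.
rewrite /inv_pronic; have h1 : (k.+1%:R : R) != 0 by rewrite pnatr_eq0.
have h2 : (k.+2%:R : R) != 0 by rewrite pnatr_eq0.
apply: (mulfI h1); rewrite mulrBr divff // invfM mulrA divff // mul1r.
by apply: (mulfI h2); rewrite mulrBr mulrCA divff // !mulr1 -[k.+2%:R]natr1 [_ + 1]addrC addrK.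
Qed.

Lemma sum_inv_pronic_le1 n : \sum_(k < n) inv_pronic k <= 1.
Proof.
have -> : \sum_(k < n) inv_pronic k = 1 - n.+1%:R^-1.
  elim: n => [|n IH]; first by rewrite big_ord0 invr1 subrr.
  by rewrite big_ord_recr /= IH inv_pronicE addrA subrK.
by rewrite gerBl invr_ge0.
Qed.

Section Prod.
Variable x : nat -> R[i].
Let S n := \sum_(k < n) normc (x k).

Let S0 n : 0 <= S n. Proof. by apply: sumr_ge0 => k _; apply: normc_ge0. Qed.
Let SS n : S n.+1 = S n + normc (x n). Proof. by rewrite /S big_ord_recr. Qed.
Let Sle n : expR (S n) <= expR (S n.+1).
Proof. by rewrite ler_expR SS lerDl normc_ge0. Qed.

Lemma normc_prod1D_le n : normc (\prod_(k < n) (1 + x k)) <= expR (S n).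
Proof.
elim: n => [|n IH]; first by rewrite big_ord0 normc1 /S big_ord0 expR0.
rewrite big_ord_recr /= SS expRD normcM ler_pM ?normc_ge0 //.
by apply: le_trans (normcD _ _) _; rewrite normc1 expR_ge1Dx.
Qed.

Lemma normc_prod1D_sub1_le n :
  normc (\prod_(k < n) (1 + x k) - 1) <= S n * expR (S n).
Proof.
elim: n => [|n IH].
  by rewrite big_ord0 subrr normc0 mulr_ge0 ?expR_ge0.
rewrite big_ord_recr /= mulrDr mulr1 addrAC [X in _ <= X * _]SS mulrDl.
apply: le_trans (normcD _ _) _; apply: lerD.
  by apply: le_trans IH _; rewrite ler_wpM2l.
rewrite normcM mulrC ler_wpM2l ?normc_ge0 //.
exact: le_trans (normc_prod1D_le n) (Sle n).
Qed.

(** The error depends on the factors only through the sum of the moduli of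
    the [x k]; it is thus uniform in the number of factors. *)
Lemma normc_prod1D_sub1x_le n :
  normc (\prod_(k < n) (1 + x k) - 1 - \sum_(k < n) x k) <= S n ^+ 2 * expR (S n).
Proof.
elim: n => [|n IH].
  by rewrite !big_ord0 subrr subr0 normc0 mulr_ge0 ?expR_ge0 ?sqr_ge0.
rewrite !big_ord_recr /=.
set P := \prod_(k < n) _ in IH *; set T := \sum_(k < n) _ in IH *.
have -> : P * (1 + x n) - 1 - (T + x n) = (P - 1 - T) + x n * (P - 1) by ring.
apply: le_trans (normcD _ _) _.
apply: le_trans (_ : (S n ^+ 2 + normc (x n) * S n) * expR (S n) <= _).
  rewrite mulrDl lerD // normcM -mulrA ler_wpM2l ?normc_ge0 //.
  exact: normc_prod1D_sub1_le.
have := S0 n; have := normc_ge0 (x n); have := expR_ge0 (S n) => e0 x0 s0.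
apply: ler_pM; rewrite ?Sle //; first by rewrite addr_ge0 ?mulr_ge0 ?sqr_ge0.
by rewrite SS; nra.
Qed.
End Prod.

(** Subtracting C/(n+1) from [u n] gives a nondecreasing sequence, because
    the bound on the increments is itself the increment of -C/(n+1). *)
Lemma cvgn_of_telescope_le (u : nat -> R) (C : R) :
  (forall n, `|u n.+1 - u n| <= C * inv_pronic n) -> cvgn u.
Proof.
move=> h.
have C0 : 0 <= C.
  have := h 0%N; rewrite /inv_pronic => /(le_trans (normr_ge0 _)).
  by rewrite pmulr_lge0 // invr_gt0 mulr_gt0.
pose v n := u n - C * n.+1%:R^-1.
have vS n : v n <= v n.+1.
  have := h n; rewrite inv_pronicE ler_norml /v => /andP[h1 _].
  move: h1; rewrite mulrBr; set p := C / _; set q := C / _; lra.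
have hinv n : (n.+1%:R^-1 : R) <= 1 by rewrite invf_le1 ?ltr0n // ler1n.
have uB n : u n <= u 0%N + C * (1 - n.+1%:R^-1).
  elim: n => [|n IH]; first by rewrite invr1 subrr mulr0 addr0.
  have := h n; rewrite inv_pronicE ler_norml => /andP[_ h2].
  move: h2 IH; rewrite !mulrBr; set p := C / _; set q := C / _; lra.
have vc : cvgn v.
  apply: nondecreasing_is_cvgn.
    by apply/nondecreasing_seqP.
  exists (u 0%N + C) => _ [n _ <-]; have := uB n; rewrite /v mulrBr mulr1.
  have : 0 <= C / n.+1%:R by rewrite mulr_ge0 ?invr_ge0.
  by set p := C / _; lra.
have -> : u = v \+ (fun n => C * harmonic n).
  by apply/funext => n; rewrite /v /harmonic /= subrK.
apply: is_cvgD => //; apply/cvg_ex; exists (C * 0).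
by apply: cvgMr; apply: cvg_harmonic.
Qed.

Lemma ctends_of_telescope_le (u : nat -> R[i]) (C : R) :
  (forall n, normc (u n.+1 - u n) <= C * inv_pronic n) -> exists l, ctends \oo u l.
Proof.
move=> h.
have hre : cvgn (fun n => complex.Re (u n)).
  apply: (@cvgn_of_telescope_le _ C) => n; apply: le_trans (h n).
  by rewrite -ReN -ReD absRe_le_normc.
have him : cvgn (fun n => complex.Im (u n)).
  apply: (@cvgn_of_telescope_le _ C) => n; apply: le_trans (h n).
  by apply: le_trans (Im_le_normc _); case: (u n.+1) (u n) => [? ?] [? ?].
have [a ha] := (cvg_ex _).1 hre; have [b hb] := (cvg_ex _).1 him.
exists (a +i* b)%C; apply: (ctends_squeeze
   (g := fun n => `|complex.Re (u n) - a| + `|complex.Im (u n) - b|)).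
  apply: nearW => n; apply: le_trans (normc_complex _ _); rewrite le_eqVlt; apply/orP; left.
  apply/eqP; congr normc; case: (u n) => x y.
  by apply/eqP; rewrite eq_complex /=; apply/andP; split; apply/eqP; ring.
rewrite -[0 : R]addr0; apply: cvgD.
  by apply/norm_cvg0P; rewrite -(subrr a); apply: cvgB => //; apply: cvg_cst.
by apply/norm_cvg0P; rewrite -(subrr b); apply: cvgB => //; apply: cvg_cst.
Qed.

Lemma sum_le_inv_pronic (x : nat -> R[i]) (C : R) n :
  (forall k, normc (x k) <= C * inv_pronic k) -> \sum_(k < n) normc (x k) <= C.
Proof.
move=> h; have C0 : 0 <= C.
  have := h 0%N; rewrite /inv_pronic => /(le_trans (normc_ge0 _)).
  by rewrite pmulr_lge0 // invr_gt0 mulr_gt0.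
apply: le_trans (_ : \sum_(k < n) C * inv_pronic k <= _); first by apply: ler_sum.
by rewrite -mulr_sumr ler_piMr // sum_inv_pronic_le1.
Qed.

Lemma ctends_prod1D (x : nat -> R[i]) (C : R) :
  (forall k, normc (x k) <= C * inv_pronic k) ->
  exists l, ctends \oo (fun n => \prod_(k < n) (1 + x k)) l.
Proof.
move=> h; apply: (@ctends_of_telescope_le _ (expR C * C)) => n.
rewrite big_ord_recr /= mulrDr mulr1 addrAC subrr add0r normcM -mulrA.
rewrite ler_pM ?normc_ge0 //; apply: le_trans (normc_prod1D_le _ _) _.
by rewrite ler_expR sum_le_inv_pronic.
Qed.

Lemma ctends_sum_inv_pronic (x : nat -> R[i]) (C : R) :
  (forall k, normc (x k) <= C * inv_pronic k) ->
  exists l, ctends \oo (fun n => \sum_(k < n) x k) l.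
Proof.
move=> h; apply: (@ctends_of_telescope_le _ C) => n.
by rewrite big_ord_recr /= addrAC subrr add0r.
Qed.
End Products.

(** * Factors of Euler's sequence *)

Section EulerFactors.
Variable R : realType.
Implicit Types (z w h : R[i]).
Local Notation inv_pronic := (@inv_pronic R).

Definition nonpole z := forall n : nat, z != - n%:R.

(** As [ln 0 = 0], the increments sum up to [ln n] from k = 0 on, without a
    special first term. *)
Definition dln (k : nat) : R := ln k.+1%:R - ln k%:R.

(** The sequence whose limit defines Gamma. *)
Definition euler n z : R[i] := n`!%:R * cnatpow n (z - 1) / poch z n.

(** The k-th factor of the quotient of [euler n (z + h)] by [euler n z]. *)
Definition euler_factor z h k := cexp (h * (dln k)%:C%C) * ((z + k%:R) / (z + h + k%:R)).

(** The coefficient of h in [euler_factor z h k]. *)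
Definition psi_term z k := (dln k)%:C%C - (z + k%:R)^-1.

Lemma pochS (F : pzRingType) (x : F) n : poch x n.+1 = poch x n * (x + n%:R).
Proof. by rewrite /poch big_ord_recr. Qed.
Lemma poch0 (F : pzRingType) (x : F) : poch x 0 = 1.
Proof. by rewrite /poch big_ord0. Qed.

Lemma nonpoleD_neq0 z k : nonpole z -> z + k%:R != 0.
Proof. by move=> /(_ k); rewrite addr_eq0. Qed.

Lemma poch_neq0 z n : nonpole z -> poch z n != 0.
Proof. by move=> hz; apply/prodf_neq0 => k _; apply: nonpoleD_neq0. Qed.

Lemma sum_dln n : \sum_(k < n) dln k = ln n%:R.
Proof.
elim: n => [|n IH]; first by rewrite big_ord0 ln0.
by rewrite big_ord_recr /= IH /dln addrC subrK.
Qed.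

Lemma dln_ge0 k : 0 <= dln k.
Proof.
rewrite subr_ge0; case: k => [|k]; first by rewrite ln0 // ln1.
by rewrite ler_ln ?posrE // ler_nat.
Qed.

(** For k > 0, applying ln (1 + x) <= x at x = 1/k and at x = -1/(k+1) gives
    1/(k+1) <= dln k <= 1/k; the constant 3 is what k = 1 needs. *)
Lemma dln_approx k : `|dln k - k.+1%:R^-1| <= 3 * inv_pronic k.
Proof.
case: k => [|k].
  rewrite /dln ln1 ln0 // subr0 sub0r normrN invr1 normr1 /inv_pronic mul1r.
  by rewrite ler_pdivlMr ?ltr0n // mul1r ler_nat.
have k0 : (0 : R) < k.+1%:R by rewrite ltr0n.
have k1 : (0 : R) < k.+2%:R by rewrite ltr0n.
have k2 : (0 : R) < k.+3%:R by rewrite ltr0n.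
have kk : (k.+2%:R : R) = k.+1%:R + 1 by rewrite natr1.
have kkk : (k.+3%:R : R) = k.+1%:R + 2 by rewrite -[k.+3]addn2 natrD.
have k3 : (1 : R) <= k.+1%:R by rewrite ler1n.
have up : dln k.+1 <= k.+1%:R^-1.
  rewrite /dln -ln_div ?posrE // kk mulrDl divff ?gt_eqF // mul1r.
  by apply: le_ln1Dx; apply: lt_trans (_ : 0 < _); rewrite ?invr_gt0 // ltrN10.
have lo : k.+2%:R^-1 <= dln k.+1.
  rewrite -lerN2 /dln opprB -ln_div ?posrE //.
  have -> : (k.+1%:R : R) = k.+2%:R - 1 by rewrite kk addrK.
  rewrite mulrBl divff ?gt_eqF // mul1r; apply: le_ln1Dx.
  by rewrite ltrN2 invf_lt1 // ltr1n.
rewrite ger0_norm ?subr_ge0 //; apply: le_trans (_ : k.+1%:R^-1 - k.+2%:R^-1 <= _).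
  by rewrite lerD2r.
have -> : (k.+1%:R^-1 - k.+2%:R^-1 : R) = (k.+1%:R * k.+2%:R)^-1.
  by rewrite -/(inv_pronic _) -inv_pronicE.
rewrite /inv_pronic ler_pdivlMr ?mulr_gt0 // mulrC ler_pdivrMr ?mulr_gt0 //.
rewrite kkk kk; nra.
Qed.

Lemma sqr_inv_le_inv_pronic k : (k.+1%:R^-1 : R) ^+ 2 <= 2 * inv_pronic k.
Proof.
have k0 : (0 : R) < k.+1%:R by rewrite ltr0n.
have k1 : (0 : R) < k.+2%:R by rewrite ltr0n.
have k3 : (1 : R) <= k.+1%:R by rewrite ler1n.
have kk : (k.+2%:R : R) = k.+1%:R + 1 by rewrite natr1.
rewrite exprVn /inv_pronic ler_pdivlMr ?mulr_gt0 // mulrC ler_pdivrMr ?exprn_gt0 //.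
by rewrite kk; nra.
Qed.

Lemma dln_le k : dln k <= 2 / k.+1%:R.
Proof.
case: k => [|k]; first by rewrite /dln ln1 ln0 // subrr.
have k0 : (0 : R) < k.+1%:R by rewrite ltr0n.
have k1 : (0 : R) < k.+2%:R by rewrite ltr0n.
have kk : (k.+2%:R : R) = k.+1%:R + 1 by rewrite natr1.
rewrite /dln -ln_div ?posrE // [X in ln (X / _)]kk mulrDl divff ?gt_eqF // mul1r.
rewrite [X in ln X]addrC [X in ln X]addrC.
apply: le_trans (le_ln1Dx _) _; first by apply: lt_trans (_ : 0 < _); rewrite ?invr_gt0 // ltrN10.
rewrite ler_pdivlMr // mulrC ler_pdivrMr // kk.
have k3 : (1 : R) <= k.+1%:R by rewrite ler1n.
lra.
Qed.

(** For k >= 2|z| + 1 the triangle inequality gives half of k + 1; the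
    finitely many remaining values are nonzero. *)
Lemma nonpole_lower_bound z : nonpole z ->
  exists2 rho : R, 0 < rho & forall k, rho * k.+1%:R <= normc (z + k%:R).
Proof.
move=> hz.
have fin K : exists2 rho : R, 0 < rho & forall k, (k < K)%N -> rho * k.+1%:R <= normc (z + k%:R).
  elim: K => [|K [rho r0 IH]]; first by exists 1.
  exists (Num.min rho (normc (z + K%:R) / K.+1%:R)).
    by rewrite lt_min r0 divr_gt0 // normc_gt0 nonpoleD_neq0.
  move=> k; rewrite ltnS leq_eqVlt => /orP[/eqP ->|kK].
    apply: le_trans (_ : normc (z + K%:R) / K.+1%:R * K.+1%:R <= _).
      by rewrite ler_wpM2r // ge_min lexx orbT.
    by rewrite divfK // pnatr_eq0.
  by apply: le_trans (IH _ kK); rewrite ler_wpM2r // ge_min lexx.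
pose K := (Num.bound (2 * normc z + 1)).
have [rho r0 h] := fin K; exists (Num.min rho (1 / 2)); first by rewrite lt_min r0 divr_gt0.
move=> k; case: (ltnP k K) => kK.
  by apply: le_trans (h _ kK); rewrite ler_wpM2r // ge_min lexx.
apply: le_trans (_ : 1 / 2 * k.+1%:R <= _).
  by rewrite ler_wpM2r // ge_min lexx orbT.
have h1 : 2 * normc z + 1 <= k%:R.
  apply: le_trans (_ : K%:R <= _); last by rewrite ler_nat.
  by apply: le_trans (ltW (archi_boundP _)); rewrite ?addr_ge0 ?mulr_ge0 ?normc_ge0.
have h2 : k%:R <= normc (z + k%:R) + normc z.
  by rewrite -[X in X <= _](normc_nat R k) -(normcN z) -{1}[k%:R](addKr z) addrC normcD.
rewrite -(natr1 k); lra.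
Qed.

(** Both [dln k] and 1/(z+k) differ from 1/(k+1) by O(1/k^2). *)
Lemma psi_term_le z : nonpole z ->
  exists2 C : R, 0 <= C & forall k, normc (psi_term z k) <= C * inv_pronic k.
Proof.
move=> hz; have [rho r0 hr] := nonpole_lower_bound hz.
exists (3 + 2 * ((normc z + 1) / rho)).
  by rewrite addr_ge0 ?mulr_ge0 ?invr_ge0 ?addr_ge0 ?normc_ge0 // ltW.
move=> k; have zk := nonpoleD_neq0 k hz.
have k1 : (k.+1%:R : R[i]) != 0 by rewrite pnatr_eq0.
have -> : psi_term z k = (dln k - k.+1%:R^-1)%:C%C + (z - 1) * (k.+1%:R^-1 * (z + k%:R)^-1).
  rewrite /psi_term; move: (dln k) => q; rewrite rmorphB fmorphV rmorph_nat -addrA; congr (_ + _).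
  rewrite -natr1 in k1 *; field.
  by rewrite k1 zk.
apply: le_trans (normcD _ _) _; rewrite [X in _ <= X]mulrDl normc_real; apply: lerD;
  first exact: dln_approx.
rewrite !normcM !normcV normc_nat.
have -> : 2 * ((normc z + 1) / rho) * inv_pronic k
  = (normc z + 1) * (rho^-1 * (2 * inv_pronic k)) by ring.
apply: ler_pM; rewrite ?normc_ge0 ?mulr_ge0 ?invr_ge0 ?normc_ge0 //.
  by apply: le_trans (normcB _ _) _; rewrite normc1.
rewrite mulrC; apply: le_trans (_ : rho^-1 * k.+1%:R^-1 ^+ 2 <= _); last first.
  by rewrite ler_wpM2l ?invr_ge0 ?sqr_inv_le_inv_pronic // ltW.
rewrite expr2 mulrA ler_wpM2r ?invr_ge0 // -invfM lef_pV2 ?posrE ?mulr_gt0 //.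
by rewrite normc_gt0.
Qed.
End EulerFactors.

(** * Convergence of Euler's limit *)

Section EulerLimit.
Variable R : realType.
Implicit Types (z w h : R[i]).
Local Notation inv_pronic := (@inv_pronic R).
Local Notation dln := (@dln R).

Lemma cexp_sum n (x : nat -> R[i]) : cexp (\sum_(k < n) x k) = \prod_(k < n) cexp (x k).
Proof.
elim: n => [|n IH]; first by rewrite !big_ord0 cexp0.
by rewrite !big_ord_recr /= cexpD IH.
Qed.

Lemma cnatpowD n z w : cnatpow n (z + w) = cnatpow n z * cnatpow n w.
Proof. by rewrite /cnatpow mulrDl cexpD. Qed.
Lemma cnatpow_neq0 n z : cnatpow n z != 0.
Proof. exact: cexp_neq0. Qed.
Lemma cnatpow0 n : cnatpow n 0 = 1 :> R[i].
Proof. by rewrite /cnatpow mul0r cexp0. Qed.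

Lemma fact_neq0 n : (n`!%:R : R[i]) != 0.
Proof. by rewrite pnatr_eq0 -lt0n fact_gt0. Qed.

Lemma euler_neq0 n z : nonpole z -> euler n z != 0.
Proof.
move=> hz; apply: mulf_neq0; last by rewrite invr_eq0 poch_neq0.
by rewrite mulf_neq0 ?cnatpow_neq0 ?fact_neq0.
Qed.

(** The power n^h is spread over the n factors, as ln n is the sum of the
    [dln k]. *)
Lemma euler_ratio n z h : nonpole z -> nonpole (z + h) ->
  euler n (z + h) / euler n z = \prod_(k < n) euler_factor z h k.
Proof.
move=> hz hzh.
have e1 : \prod_(k < n) cexp (h * (dln k)%:C%C) = cnatpow n h.
  by rewrite /cnatpow -sum_dln rmorph_sum mulr_sumr (cexp_sum n (fun k => h * (dln k)%:C%C)).
rewrite /euler_factor big_split /= e1 prodf_div -/(poch z n) -/(poch (z + h) n).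
have e2 : z + h - 1 = h + (z - 1) by ring.
rewrite /euler e2 (cnatpowD n h).
move: (cnatpow_neq0 n (z - 1)) (poch_neq0 n hz) (poch_neq0 n hzh) (fact_neq0 n).
move: (poch z n) (poch (z + h) n) (cnatpow n h) (cnatpow n (z - 1)) => p q e f f0 p0 q0 n0.
by field; rewrite f0 p0 q0 n0.
Qed.

Lemma poch1 n : poch (1 : R[i]) n = n`!%:R.
Proof.
elim: n => [|n IH]; first by rewrite poch0.
by rewrite pochS IH factS natrM mulrC addrC natr1.
Qed.

Lemma euler1 n : euler n 1 = 1 :> R[i].
Proof. by rewrite /euler subrr cnatpow0 mulr1 poch1 divff ?fact_neq0. Qed.

Lemma nonpole1 : nonpole (1 : R[i]).
Proof. by move=> n; rewrite -addr_eq0 addrC natr1 pnatr_eq0. Qed.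

(* The constant of [cexp_sub1x_le] on the disc of radius 2B, which contains
   h dln k when |h| <= B, as dln k <= 2. *)
Let K (B : R) := expR (2 * B) + (1 + 2 * B) * 2 + 1.

(** With L = dln k and w = h/(z+k), the left-hand side is
    (e^(hL) - 1 - hL - w (hL - w)) / (1 + w), where L and w/h are O(1/k).
    The radius [B] is arbitrary: the existence of Gamma uses an increment h
    that is not small. *)
Lemma euler_factor_expand (z : R[i]) (rho B : R) : 0 < rho -> 0 <= B ->
  (forall k, rho * k.+1%:R <= normc (z + k%:R)) ->
  exists2 C : R, 0 <= C & forall h, normc h <= B ->
    (forall k, rho * k.+1%:R <= normc (z + h + k%:R)) ->
    forall k, normc (euler_factor z h k - 1 - h * psi_term z k)
      <= C * normc h ^+ 2 * inv_pronic k.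
Proof.
move=> r0 B0 hz; set r := rho^-1; have r0' : 0 < r by rewrite invr_gt0.
have nz := normc_ge0 z.
have K0 : 0 <= K B.
  by rewrite /K !addr_ge0 ?expR_ge0 ?mulr_ge0 // addr_ge0 // mulr_ge0.
exists (2 * ((normc z + 1) * r * (4 * K B + r * (2 + r)))).
  by rewrite !(mulr_ge0, addr_ge0) // ltW.
move=> h hB hzh k; set N := normc h; set t : R := k.+1%:R^-1.
have N0 : 0 <= N by apply: normc_ge0.
have t0 : 0 < t by rewrite invr_gt0 ltr0n.
have t1 : t <= 1 by rewrite invf_le1 ?ltr0n // ler1n.
have lb0 w : rho * k.+1%:R <= normc (w + k%:R) -> w + k%:R != 0 /\ normc (w + k%:R)^-1 <= r * t.
  move=> hw; have p : 0 < rho * k.+1%:R by rewrite mulr_gt0 // ltr0n.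
  have q : 0 < normc (w + k%:R) by apply: lt_le_trans hw.
  split; first by rewrite -normc_gt0.
  by rewrite normcV -invfM lef_pV2 ?posrE.
have [zk izk] := lb0 _ (hz k); have [zhk izhk] := lb0 _ (hzh k).
set L := (dln k)%:C%C : R[i]; set w := h / (z + k%:R).
have -> : euler_factor z h k - 1 - h * psi_term z k =
   ((cexp (h * L) - 1 - h * L) - w * (h * L - w)) * ((z + k%:R) * (z + h + k%:R)^-1).
  rewrite /euler_factor /psi_term -/L /w; set e := cexp _.
  by rewrite addrAC in zhk *; field; rewrite zk zhk.
have hL : normc (h * L) <= N * (2 * t).
  rewrite normcM normc_real ger0_norm ?dln_ge0 // ler_wpM2l //.
  exact: dln_le.
have hw : normc w <= N * (r * t).
  by rewrite normcM ler_wpM2l.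
have hL2 : normc (h * L) <= 2 * B.
  by apply: le_trans hL _; rewrite mulrCA ler_wpM2l // -[B]mulr1 ler_pM // ltW.
have e1 : normc (cexp (h * L) - 1 - h * L) <= K B * (N * (2 * t)) ^+ 2.
  apply: le_trans (cexp_sub1x_le _) _; apply: ler_pM.
  - by rewrite !addr_ge0 ?expR_ge0 ?mulr_ge0 // addr_ge0 // normc_ge0.
  - exact: sqr_ge0.
  - rewrite /K lerD2r lerD ?ler_expR // ler_wpM2r //; lra.
  - by rewrite lerXn2r ?nnegrE ?normc_ge0 // !mulr_ge0 // ltW.
have e2 : normc (w * (h * L - w)) <= N * (r * t) * (N * (2 * t) + N * (r * t)).
  rewrite normcM ler_pM ?normc_ge0 //.
  by apply: le_trans (normcB _ _) _; rewrite lerD.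
have e3 : normc ((z + k%:R) * (z + h + k%:R)^-1) <= (normc z + 1) * r.
  rewrite normcM.
  apply: le_trans (_ : ((normc z + 1) * k.+1%:R) * (r * t) <= _).
    rewrite ler_pM ?normc_ge0 //; apply: le_trans (normcD _ _) _.
    rewrite normc_nat -(natr1 k); have := ler0n R k; nra.
  by rewrite mulrACA -(natr1 k) /t -(natr1 k) divff ?mulr1 // natr1 pnatr_eq0.
rewrite normcM.
apply: le_trans (_ : (K B * (N * (2 * t)) ^+ 2 + N * (r * t) * (N * (2 * t) + N * (r * t)))
    * ((normc z + 1) * r) <= _).
  rewrite ler_pM ?normc_ge0 //.
  by apply: le_trans (normcB _ _) _; rewrite lerD.
have -> : (K B * (N * (2 * t)) ^+ 2 + N * (r * t) * (N * (2 * t) + N * (r * t)))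
    * ((normc z + 1) * r) = (normc z + 1) * r * (4 * K B + r * (2 + r)) * N ^+ 2 * t ^+ 2 by ring.
have -> : 2 * ((normc z + 1) * r * (4 * K B + r * (2 + r))) * N ^+ 2 * inv_pronic k =
   (normc z + 1) * r * (4 * K B + r * (2 + r)) * N ^+ 2 * (2 * inv_pronic k) by ring.
by rewrite ler_wpM2l ?sqr_inv_le_inv_pronic // !(mulr_ge0, addr_ge0) ?sqr_ge0 // ltW.
Qed.

Lemma euler_factor_sub1_le z (rho B : R) : 0 < rho -> 0 <= B -> nonpole z ->
  (forall k, rho * k.+1%:R <= normc (z + k%:R)) ->
  exists C1 C2 : R, [/\ 0 <= C1, 0 <= C2 & forall h, normc h <= B ->
    (forall k, rho * k.+1%:R <= normc (z + h + k%:R)) ->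
    forall k, normc (euler_factor z h k - 1 - h * psi_term z k)
      <= C1 * normc h ^+ 2 * inv_pronic k /\
      normc (euler_factor z h k - 1) <= (C1 * normc h ^+ 2 + C2 * normc h) * inv_pronic k].
Proof.
move=> r0 B0 hp hz; have [C1 C10 h1] := euler_factor_expand r0 B0 hz.
have [C2 C20 h2] := psi_term_le hp; exists C1, C2; split=> // h hB hzh k.
split; first exact: h1.
rewrite -[_ - 1](subrK (h * psi_term z k)); apply: le_trans (normcD _ _) _.
rewrite mulrDl lerD ?h1 // normcM [C2 * _]mulrC -mulrA.
by rewrite ler_wpM2l ?normc_ge0.
Qed.

Lemma ctends_prod_euler_factor z h : nonpole z -> nonpole (z + h) ->
  exists l, ctends \oo (fun n => \prod_(k < n) euler_factor z h k) l.
Proof.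
move=> hz hzh; have [r1 r10 h1] := nonpole_lower_bound hz;
  have [r2 r20 h2] := nonpole_lower_bound hzh.
have r0 : 0 < Num.min r1 r2 by rewrite lt_min r10.
have h1' k : Num.min r1 r2 * k.+1%:R <= normc (z + k%:R).
  by apply: le_trans (h1 k); rewrite ler_wpM2r // ge_min lexx.
have h2' k : Num.min r1 r2 * k.+1%:R <= normc (z + h + k%:R).
  by apply: le_trans (h2 k); rewrite ler_wpM2r // ge_min lexx orbT.
have [C1 [C2 [_ _ H]]] := euler_factor_sub1_le r0 (normc_ge0 h) hz h1'.
have [l hl] := ctends_prod1D (fun k => (H h (lexx _) h2' k).2); exists l.
by apply: ctends_ext hl => n; apply: eq_bigr => k _; rewrite subrKC.
Qed.

(** Euler's sequence is constant at 1.  Hence its value at z is a product of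
    factors with base point 1, and its inverse a product of factors with base
    point z; both converge, so the limit is invertible. *)
Lemma ctends_Gamma z : nonpole z ->
  ctends \oo (fun n => euler n z) (Gamma z) /\ Gamma z != 0.
Proof.
move=> hz.
have [l hl] : exists l, ctends \oo (fun n => euler n z) l.
  have zE : 1 + (z - 1) = z by rewrite addrC subrK.
  have [|l hl] := @ctends_prod_euler_factor 1 (z - 1) nonpole1; first by rewrite zE.
  exists l; apply: ctends_ext hl => n.
  by rewrite -euler_ratio ?zE ?euler1 ?divr1 //; exact: nonpole1.
have [k hk] : exists k, ctends \oo (fun n => (euler n z)^-1) k.
  have zE : z + (1 - z) = 1 by rewrite addrC subrK.
  have [|k hk] := @ctends_prod_euler_factor z (1 - z) hz; first by rewrite zE; apply: nonpole1.
  exists k; apply: ctends_ext hk => n.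
  by rewrite -euler_ratio ?zE ?euler1 ?div1r //; exact: nonpole1.
have GE : Gamma z = l by exact: (ctends_lim hl).
split; first by rewrite GE.
have : ctends \oo (fun=> 1 : R[i]) (l * k).
  by apply: ctends_ext (ctendsM hl hk) => n; rewrite divff ?euler_neq0.
move=> /(ctends_unique (ctends_cst 1)) e.
by rewrite GE; apply/eqP => l0; move/eqP: e; rewrite l0 mul0r oner_eq0.
Qed.
End EulerLimit.

(** * The digamma function as a series *)

Section Digamma.
Variable R : realType.
Implicit Types (z w h : R[i]).
Local Notation inv_pronic := (@inv_pronic R).
Local Notation dln := (@dln R).

(** The constants do not depend on n, so that the expansion survives the
    passage to the limit. *)
Lemma prod_euler_factor_expand z : nonpole z ->
  exists delta K : R, [/\ 0 < delta, 0 <= K & forall h, normc h <= delta ->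
    nonpole (z + h) /\ forall n,
    normc (\prod_(k < n) euler_factor z h k - 1 - h * \sum_(k < n) psi_term z k)
      <= K * normc h ^+ 2].
Proof.
(* Half of the lower bound is kept as a margin for h. *)
move=> hz; have [rho0 r00 hr] := nonpole_lower_bound hz; set rho := rho0 / 2.
have r0 : 0 < rho by rewrite divr_gt0.
have rr : rho0 = rho + rho by rewrite /rho -splitr.
have hr1 k : rho * k.+1%:R <= normc (z + k%:R).
  by apply: le_trans (hr k); rewrite rr mulrDl lerDl mulr_ge0 // ltW.
have [C1 [C2 [C10 C20 H]]] := euler_factor_sub1_le r0 ler01 hz hr1.
have C0 : 0 <= C1 + C2 by rewrite addr_ge0.
exists (Num.min 1 rho), ((C1 + C2) ^+ 2 * expR (C1 + C2) + C1); split.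
- by rewrite lt_min ltr01.
- by rewrite addr_ge0 ?mulr_ge0 ?expR_ge0 ?sqr_ge0.
move=> h; rewrite le_min => /andP[h1 hrho].
have hr2 k : rho * k.+1%:R <= normc (z + h + k%:R).
  have e : normc (z + k%:R) <= normc (z + h + k%:R) + normc h.
    by apply: le_trans (normcB _ _); rewrite addrAC addrK.
  have := hr k; rewrite rr mulrDl.
  have : rho <= rho * k.+1%:R by rewrite ler_peMr ?ler1n // ltW.
  lra.
split.
  move=> n; rewrite -addr_eq0 -normc_gt0; apply: lt_le_trans (hr2 n).
  by rewrite mulr_gt0 // ltr0n.
have H1 k := (H h h1 hr2 k).1; have H2 k := (H h h1 hr2 k).2.
move=> n; set N := normc h in h1 H1 H2 *; have N0 : 0 <= N by apply: normc_ge0.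
pose x k := euler_factor z h k - 1.
have -> : \prod_(k < n) euler_factor z h k = \prod_(k < n) (1 + x k).
  by apply: eq_bigr => k _; rewrite /x subrKC.
set P := \prod_(k < n) _; set V := \sum_(k < n) _.
have -> : P - 1 - h * V = (P - 1 - \sum_(k < n) x k) + (\sum_(k < n) x k - h * V) by ring.
apply: le_trans (normcD _ _) _; rewrite mulrDl; apply: lerD.
  apply: le_trans (normc_prod1D_sub1x_le _ _) _; set S := \sum_(k < n) _.
  have S0 : 0 <= S by apply: sumr_ge0 => k _; apply: normc_ge0.
  have SN : S <= (C1 + C2) * N.
    apply: le_trans (sum_le_inv_pronic n H2) _; rewrite mulrDl lerD2r ler_wpM2l // expr2.
    by rewrite ler_piMl.
  have SC : S <= C1 + C2 by apply: le_trans SN _; rewrite ler_piMr.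
  have -> : (C1 + C2) ^+ 2 * expR (C1 + C2) * N ^+ 2
    = ((C1 + C2) * N) ^+ 2 * expR (C1 + C2) by ring.
  rewrite ler_pM ?expR_ge0 ?sqr_ge0 ?ler_expR //.
  by rewrite lerXn2r ?nnegrE // mulr_ge0.
rewrite /V mulr_sumr -sumrB;
  apply: le_trans (ler_normc_sum n (fun k => x k - h * psi_term z k)) _.
exact: (sum_le_inv_pronic n H1).
Qed.

(** In the limit, [prod_euler_factor_expand] reads
    Gamma(z+h) / Gamma(z) = 1 + hL + O(|h|^2) with L the sum of the
    [psi_term z k]: Gamma is differentiable at z with derivative L Gamma(z). *)
Lemma ctends_psi z : nonpole z ->
  ctends \oo (fun n => \sum_(k < n) psi_term z k) (psi z).
Proof.
move=> hz; have [C _ hC] := psi_term_le hz.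
have [L hL] := ctends_sum_inv_pronic hC.
suff -> : psi z = L by [].
have [Gz G0] := ctends_Gamma hz.
have [delta [K [d0 K0 H]]] := prod_euler_factor_expand hz.
have key h : normc h <= delta ->
    normc (Gamma (z + h) / Gamma z - 1 - h * L) <= K * normc h ^+ 2.
  move=> hd; have [hzh Hn] := H h hd; have [Gzh _] := ctends_Gamma hzh.
  apply: (@ctends_normc_le _ _ \oo _
    (fun n => euler n (z + h) / euler n z - 1 - h * \sum_(k < n) psi_term z k)).
    apply: ctendsB; last by apply: ctendsM => //; apply: ctends_cst.
    apply: ctendsB; last exact: ctends_cst.
    by apply: ctendsM => //; apply: ctendsV.
  by move=> n; rewrite euler_ratio.
have id0 : normc h @[h --> (0 : (R[i] : numFieldType))^'] --> (0 : R).
  apply/cvgrPdist_lt => e e0; have e0' : 0 < e%:C%C :> R[i] by rewrite ltcR.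
  have := @dnbhs0_lt _ (R[i]^o) _ e0';
    apply: (@filterS _ (dnbhs (0 : (R[i] : numFieldType)))) => h.
  by rewrite sub0r normrN (ger0_norm (normc_ge0 _)) normr_normc ltcR.
have dG : ctends (0 : (R[i] : numFieldType))^'
    (fun h => h^-1 * (Gamma (h + z) - Gamma z)) (Gamma z * L).
  apply: (ctends_squeeze (g := fun h => normc (Gamma z) * K * normc h)).
    near=> h.
    have h0 : h != 0 by near: h; exact: (@nbhs_dnbhs_neq (R[i] : numFieldType)).
    have hd : normc h <= delta.
      near: h; apply: (cvgr_le _ id0) => //.
    have -> : h^-1 * (Gamma (h + z) - Gamma z) - Gamma z * L
       = Gamma z * (h^-1 * (Gamma (z + h) / Gamma z - 1 - h * L)).
      by rewrite [z + h]addrC; field; rewrite h0 G0.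
    rewrite !normcM -mulrA ler_wpM2l ?normc_ge0 //.
    rewrite normcV mulrC ler_pdivrMr ?normc_gt0 // -mulrA -expr2.
    exact: key.
  by rewrite -(mulr0 (normc (Gamma z) * K)); apply: cvgMr.
have dE : derive1 ((@Gamma R) : R[i] -> R[i]^o) z = Gamma z * L :> R[i] by exact: (ctends_lim dG).
by rewrite /psi dE mulrC mulKf.
Unshelve. all: by end_near.
Qed.

Lemma near_le_ln_nat (M : R) : \forall n \near \oo, M <= ln (n%:R : R).
Proof.
near=> n.
have h : expR M <= n%:R by near: n; apply: nbhs_infty_ger.
by rewrite -[M]expRK ler_ln ?posrE ?expR_gt0 // (lt_le_trans (expR_gt0 M)).
Unshelve. all: by end_near.
Qed.

Lemma expR_ln_nat_cvg0 (s : R) : 0 < s -> expR (- s * ln (n%:R : R)) @[n --> \oo] --> (0 : R).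
Proof.
move=> s0; apply/cvgrPdist_lt => e e0.
near=> n.
rewrite sub0r normrN ger0_norm ?expR_ge0 // -[e]lnK ?posrE // ltr_expR.
have : (1 - ln e) / s <= ln n%:R by near: n; apply: near_le_ln_nat.
rewrite ler_pdivrMr //; lra.
Unshelve. all: by end_near.
Qed.

Lemma euler_quot (a c : R[i]) n : nonpole a -> nonpole c ->
  poch a n / poch c n = euler n c / euler n a * cnatpow n (a - c) :> R[i].
Proof.
move=> ha hc; rewrite /euler.
have e2 : a - 1 = (a - c) + (c - 1) by ring.
rewrite e2 (cnatpowD n (a - c)).
move: (cnatpow_neq0 n (a - c)) (cnatpow_neq0 n (c - 1)) (poch_neq0 n ha) (poch_neq0 n hc).
move: (poch a n) (poch c n) (cnatpow n (a - c)) (cnatpow n (c - 1)) => p q e f e0 f0 p0 q0.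
have n0 := @fact_neq0 R n.
by field; rewrite e0 f0 p0 q0 n0.
Qed.

(** The quotient is G_n(c) / G_n(a) n^(a-c), with G_n Euler's sequence, and
    n^(a-c) has modulus n^(-Re (c-a)).  This needs G_n(a) to make sense, but
    when a is a pole of Gamma the quotient vanishes for n large. *)
Lemma ctends_poch_quot_decay (a c : R[i]) (p : nat) : nonpole c -> p%:R < complex.Re (c - a) ->
  ctends \oo (fun n => poch a n / poch c n * n%:R ^+ p) 0.
Proof.
move=> hc hca; case: (pselect (exists q : nat, a = - q%:R)) => [[q aq]|na].
  apply: ctends_near (ctends_cst 0); near=> n.
  have qn : (q < n)%N by near: n; apply: nbhs_infty_gt.
  suff -> : poch a n = 0 by rewrite mul0r mul0r.
  by apply/eqP/prodf_eq0; exists (Ordinal qn) => //=; rewrite aq addNr.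
have ha : nonpole a by move=> n; apply/eqP => e; apply: na; exists n.
have [Ga Ga0] := ctends_Gamma ha; have [Gc _] := ctends_Gamma hc.
pose s := complex.Re (c - a) - p%:R; have s0 : 0 < s by rewrite subr_gt0.
have q : normc (euler n c / euler n a) @[n --> \oo] --> normc (Gamma c / Gamma a).
  by apply: ctends_normc; apply: ctendsM => //; apply: ctendsV.
apply: (ctends_squeeze (g := fun n => normc (euler n c / euler n a) * expR (- s * ln n%:R))).
  near=> n.
  have n0 : (0 < n)%N by near: n; apply: nbhs_infty_gt.
  rewrite subr0 euler_quot // -(mulrA (euler n c / euler n a)) normcM ler_wpM2l ?normc_ge0 //.
  rewrite normcM.
  have -> : normc (n%:R ^+ p : R[i]) = expR (p%:R * ln n%:R).
    by rewrite -natrX normc_nat natrX mulrC expRM_natr lnK // posrE ltr0n.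
  rewrite /cnatpow normc_cexp -expRD ler_expR /s le_eqVlt; apply/orP; left; apply/eqP.
  have -> : complex.Re ((a - c) * (ln n%:R)%:C%C) = complex.Re (a - c) * ln n%:R.
    by case: (a - c) => x y /=; rewrite mulr0 subr0.
  rewrite !ReD !ReN; ring.
rewrite -(mulr0 (normc (Gamma c / Gamma a))); apply: cvgM q _; exact: expR_ln_nat_cvg0.
Unshelve. all: by end_near.
Qed.

Lemma ctends_nat_quot z : nonpole z -> ctends \oo (fun n => n%:R / (z + n%:R)) 1.
Proof.
move=> hz; have [rho r0 hr] := nonpole_lower_bound hz.
apply: (ctends_squeeze (g := fun n => normc z / rho * harmonic n)).
  apply: nearW => n; have zn := nonpoleD_neq0 n hz.
  have -> : n%:R / (z + n%:R) - 1 = - (z * (z + n%:R)^-1) by field.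
  rewrite normcN normcM normcV -mulrA ler_wpM2l ?normc_ge0 //.
  by rewrite /harmonic /= -invfM lef_pV2 ?posrE ?normc_gt0 // mulr_gt0 // ltr0n.
by rewrite -(mulr0 (normc z / rho)); apply: cvgMr; apply: cvg_harmonic.
Qed.

Lemma poch_shift (F : comPzRingType) (x : F) n : x * poch (x + 1) n = poch x n * (x + n%:R).
Proof.
elim: n => [|n IH]; first by rewrite !poch0 addr0 mulr1 mul1r.
by rewrite pochS mulrA IH -pochS pochS; congr (_ * _); rewrite -addrA nat1r.
Qed.

(** Euler's sequence at z + 1 is z n / (z+n) times that at z. *)
Lemma GammaS z : nonpole z -> nonpole (z + 1) -> Gamma (z + 1) = z * Gamma z.
Proof.
move=> hz hz1; have [Gz _] := ctends_Gamma hz; have [Gz1 _] := ctends_Gamma hz1.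
have h : ctends \oo (fun n => z * euler n z * (n%:R / (z + n%:R))) (z * Gamma z * 1).
  by apply: ctendsM; [apply: ctendsM => //; apply: ctends_cst | exact: ctends_nat_quot].
rewrite -[RHS]mulr1; apply: ctends_unique Gz1 _; apply: ctends_near h; near=> n.
have n0 : (0 < n)%N by near: n; apply: nbhs_infty_gt.
have e1 : cnatpow n 1 = n%:R :> R[i].
  rewrite /cnatpow mul1r /cexp /= cos0 sin0 mulr0 addr0 mulr1 lnK ?rmorph_nat //.
  by rewrite posrE ltr0n.
have := poch_shift z n; have zn := nonpoleD_neq0 n hz.
have z0 := nonpoleD_neq0 0 hz; rewrite addr0 in z0.
have e2 : z + 1 - 1 = 1 + (z - 1) by ring.
rewrite /euler e2 (cnatpowD n 1) e1.
move: (poch_neq0 n hz) (poch_neq0 n hz1) (cnatpow n (z - 1)).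
move: (poch z n) (poch (z + 1) n) => p q p0 q0 e E.
have -> : q = p * (z + n%:R) / z by rewrite -E mulrC mulKf.
by field; rewrite z0 p0 zn.
Unshelve. all: by end_near.
Qed.

Lemma Gamma_nat k : Gamma (k.+1%:R : R[i]) = k`!%:R.
Proof.
have np j : nonpole (j.+1%:R : R[i]).
  by move=> n; rewrite -addr_eq0 -natrD addSn pnatr_eq0.
elim: k => [|k IH].
  have [h _] := ctends_Gamma (np 0); apply: ctends_unique h _.
  by apply: ctends_ext (ctends_cst 1) => n; rewrite euler1.
rewrite -(natr1 k.+1) GammaS // ?natr1 //.
by rewrite IH factS natrM.
Qed.
End Digamma.

(** * Telescoping sums of Pochhammer quotients *)

Section Telescoping.

Lemma ffactSr_diff (F : comPzRingType) (j e : nat) :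
  ((j.+1 ^_ e.+1)%:R : F) = (j ^_ e.+1)%:R + e.+1%:R * (j ^_ e)%:R.
Proof.
rewrite ffactSS ffactnSr -natrM -natrD; congr (_%:R).
case: (leqP e j) => ej; last by rewrite ffact_small // !muln0.
by rewrite [(e.+1 * _)%N]mulnC -mulnDr addnS subnK // mulnC.
Qed.

Lemma natr_ffact_diff (F : comPzRingType) (j e : nat) :
  ((j ^_ e)%:R * (j%:R - e%:R) : F) = (j ^_ e.+1)%:R.
Proof.
case: (leqP e j) => ej; first by rewrite -natrB // -natrM ffactnSr.
by rewrite !ffact_small ?mul0r // ltnW.
Qed.

Variables (F : fieldType).
Implicit Types a c : F.

(** The increments in j of (a)_(j+1) / (c)_j j^_e telescope to the first two
    terms on the right.  Expanding (j+1)^_e and j j^_(e-1) in j^_e and j^_(e-1)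
    turns each increment into the summands of the two sums.  For e = 0 the
    value of [e.-1] is immaterial, the coefficient of its sum being 0. *)
Lemma telescope_poch_ffact a c (e n : nat) : (forall j, c + j%:R != 0) ->
  (1 + a - c + e%:R) * (\sum_(j < n) poch a j.+1 / poch c j.+1 * (j ^_ e)%:R)
  = poch a n.+1 / poch c n * (n ^_ e)%:R - a * (e == 0%N)%:R
    - (e%:R * (a + e%:R)) * (\sum_(j < n) poch a j.+1 / poch c j.+1 * (j ^_ e.-1)%:R).
Proof.
move=> hc; have pc k : poch c k != 0 by apply/prodf_neq0 => i _; apply: hc.
elim: n => [|n IH].
  rewrite !big_ord0 !mulr0 subr0 poch0 divr1 pochS poch0 mul1r addr0.
  by case: e => [|e]; rewrite ?ffactn0 ?ffact0n subrr.
rewrite !big_ord_recr /= !mulrDr IH.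
rewrite (pochS a n.+1) (pochS c n).
have -> : ((n.+1 ^_ e)%:R : F) = (n ^_ e)%:R + e%:R * (n ^_ e.-1)%:R.
  by case: e {IH} => [|e]; rewrite ?ffactn0 ?mul0r ?addr0 // ffactSr_diff.
(* That is, n n^_(e-1) = n^_e + (e-1) n^_(e-1) when e > 0. *)
have E : e%:R * ((n ^_ e.-1)%:R * (n%:R - (e%:R - 1)) - (n ^_ e)%:R) = 0 :> F.
  case: e {IH} => [|e]; first by rewrite mul0r.
  by rewrite -{1}(natr1 e) /= -(natr1 e) addrK natr_ffact_diff subrr mulr0.
move: (poch a n.+1) (poch c n) (pc n) ((n ^_ e)%:R) ((n ^_ e.-1)%:R) (hc n) E => p q q0 x y cn E.
have -> : p * (a + n.+1%:R) / (q * (c + n%:R)) * (x + e%:R * y) =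
  p * (a + n.+1%:R) / (q * (c + n%:R)) * (x + e%:R * y)
  - p / (q * (c + n%:R)) * (e%:R * (y * (n%:R - (e%:R - 1)) - x)).
  by rewrite E mulr0 subr0.
rewrite -(natr1 n); field; rewrite q0 cn //.
Qed.
End Telescoping.

(** * Powers as sums of falling factorials *)

Section Stirling.
Local Open Scope set_scope.
Local Notation set0 := finset.set0.

Lemma preim_partition_pblockE (T : finType) (rT : eqType) (f : T -> rT) (x : T) :
  finset.pblock (preim_partition f [set: T]) x = [set y | f x == f y].
Proof.
have eqv : {in [set: T] & &, equivalence_rel [rel x y | f x == f y]}.
  by move=> u v w _ _ _; split=> //= /eqP ->.
apply/finset.setP => y; rewrite inE (pblock_equivalence_partition eqv) ?inE //.
Qed.

(** A map whose fibres are the blocks of P is the same thing as an injective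
    map defined on the set of blocks. *)
Lemma card_preim_partition (T rT : finType) (P : {set {set T}}) :
  finset.partition P [set: T] ->
  #|[set f : {ffun T -> rT} | preim_partition f [set: T] == P]| = #|rT| ^_ #|P|.
Proof.
move=> partP.
have [/eqP covP trivP nP] := and3P partP.
have memP x : finset.pblock P x \in P by rewrite pblock_mem // covP inE.
pose D := {B : {set T} | B \in P}.
pose cls (x : T) : D := exist _ (finset.pblock P x) (memP x).
pose F (g : {ffun D -> rT}) : {ffun T -> rT} := [ffun x => g (cls x)].
have clsP (B : D) : exists x, cls x == B.
  case: B => B BP; have : B != set0 by apply: contraNneq nP => <-.
  case/set0Pn => x xB; exists x; apply/eqP/val_inj => /=.
  exact: def_pblock BP xB.
have cls_eq x y : (cls x == cls y) = (y \in finset.pblock P x).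
  rewrite -(inj_eq val_inj) /= eq_pblock ?covP ?inE //.
have Finj : injective F.
  move=> g1 g2 /ffunP h; apply/ffunP => B; have [x /eqP <-] := clsP B.
  by have := h x; rewrite !ffunE.
rewrite -(card_sig (mem P)) -card_inj_ffuns -(card_imset _ Finj).
apply: eq_card => f; rewrite inE; apply/eqP/imsetP.
- move=> fP; pose g : {ffun D -> rT} := [ffun B : D => f (xchoose (clsP B))].
  have fE x y : (f x == f y) = (cls x == cls y).
    by rewrite cls_eq -fP preim_partition_pblockE inE.
  exists g; last first.
    apply/ffunP => x; rewrite !ffunE; apply/eqP; rewrite eq_sym fE.
    exact: (xchooseP (clsP (cls x))).
  rewrite inE; apply/injectiveP => B1 B2; rewrite !ffunE => /eqP.
  by rewrite fE (eqP (xchooseP (clsP B1))) (eqP (xchooseP (clsP B2))) => /eqP.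
- case=> g; rewrite inE => /injectiveP ginj ->.
  rewrite -[RHS](preim_partition_pblock partP).
  apply: eq_in_imset => x _; apply/finset.setP => y; rewrite !inE /= !ffunE (inj_eq ginj).
  by rewrite -(inj_eq val_inj).
Qed.

(** Sort the maps from a set of size j to a set of size k by their partition
    into fibres. *)
Lemma expn_sum_stirling2 (j k : nat) :
  (k ^ j = \sum_(l < j.+1) stirling2 j l * k ^_ l)%N.
Proof.
have -> : (k ^ j = #|{: {ffun 'I_j -> 'I_k}}|)%N by rewrite card_ffun !card_ord.
pose Q : {set {set {set 'I_j}}} := [set P | finset.partition P [set: 'I_j]].
have -> : #|{: {ffun 'I_j -> 'I_k}}| = (\sum_(P in Q) k ^_ #|P|)%N.
  rewrite -sum1_card.
  rewrite (partition_big (fun f : {ffun 'I_j -> 'I_k} => preim_partition f [set: 'I_j]) (mem Q)) /=.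
    apply: eq_bigr => P; rewrite inE => hP.
    rewrite -[in RHS](card_ord k) -(card_preim_partition _ hP) -sum1_card.
    by apply: eq_bigl => f; rewrite inE.
  by move=> f _; rewrite inE; apply: preim_partitionP.
have hQ P : P \in Q -> (#|P| < j.+1)%N.
  rewrite inE ltnS => hP; rewrite -[X in (_ <= X)%N](card_ord j) -cardsT.
  rewrite (card_partition hP) -sum1_card; apply: leq_sum => B BP.
  by rewrite card_gt0; apply: contraTneq BP => ->; case/and3P: hP.
rewrite (partition_big (fun P : {set {set 'I_j}} => inord #|P| : 'I_j.+1) predT) //=.
apply: eq_bigr => l _; rewrite /stirling2 -sum1_card big_distrl /=.
rewrite (eq_bigl (fun P => (P \in Q) && (#|P| == l))); last first.
  move=> P; case: (boolP (P \in Q)) => //= hP.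
  by rewrite -val_eqE /= inordK ?hQ.
rewrite [RHS](eq_bigl (fun P => (P \in Q) && (#|P| == l))); last by move=> P; rewrite !inE.
by apply: eq_bigr => P /andP[_ /eqP ->]; rewrite mul1n.
Qed.
End Stirling.

(** * The two kinds of series *)

Section Series.
Variable R : realType.
Implicit Types (a c z : R[i]).

Lemma nonpole_Re_gt0 z : 0 < complex.Re z -> nonpole z.
Proof.
move=> h n; apply/eqP => e; move: h; rewrite e ReN Re_nat ltNge.
by rewrite oppr_le0 ler0n.
Qed.

Lemma nonpoleD z n : nonpole z -> nonpole (z + n%:R).
Proof. by move=> hz k; rewrite -addr_eq0 -addrA -natrD nonpoleD_neq0. Qed.

Lemma ffact_le_expn n e : (n ^_ e <= n ^ e)%N.
Proof.
elim: e => [|e IH]; first by rewrite ffactn0.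
by rewrite ffactnSr expnSr leq_mul // leq_subr.
Qed.

(** The boundary term has modulus at most (|a| + 1) n^(e+1) |(a)_n / (c)_n|. *)
Lemma ctends_boundary_term a c e : nonpole c -> e.+1%:R < complex.Re (c - a) ->
  ctends \oo (fun n => poch a n.+1 / poch c n * (n ^_ e)%:R) 0.
Proof.
move=> hc hca; have h := ctends_poch_quot_decay hc hca.
apply: (ctends_squeeze (g := fun n => (normc a + 1) * normc (poch a n / poch c n * n%:R ^+ e.+1 - 0))).
  near=> n; have n0 : (0 < n)%N by near: n; apply: nbhs_infty_gt.
  have -> : poch a n.+1 / poch c n * (n ^_ e)%:R - 0
     = (a + n%:R) * (n ^_ e)%:R * (poch a n / poch c n) by rewrite pochS subr0; ring.
  rewrite subr0 [X in X <= _]normcM [X in _ <= _ * X]normcM.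
  rewrite mulrCA [X in X <= _]mulrC ler_wpM2l ?normc_ge0 //.
  rewrite normcM -natrX !normc_nat expnS natrM mulrA.
  apply: ler_pM; rewrite ?normc_ge0 ?ler0n // ?ler_nat ?ffact_le_expn //.
  apply: le_trans (normcD _ _) _; rewrite normc_nat mulrDl mul1r lerD2r.
  by rewrite ler_peMr ?normc_ge0 // ler1n.
by rewrite -(mulr0 (normc a + 1)); apply: cvgMr.
Unshelve. all: by end_near.
Qed.

(** Gauss's theorem for 2F1(a+e+1, e+1; c+e+1; 1), up to a constant factor.
    Each step of the induction is [telescope_poch_ffact] in the limit. *)
Lemma ctends_sum_poch_ffact a c e : nonpole c -> e.+1%:R < complex.Re (c - a) ->
  ctends \oo (fun n => \sum_(j < n) poch a j.+1 / poch c j.+1 * (j ^_ e)%:R)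
    ((-1) ^+ e.+1 * poch a e.+1 * (e`!)%:R / poch (1 + a - c) e.+1).
Proof.
move=> hc; have hc' j : c + j%:R != 0 by apply: nonpoleD_neq0.
have D0 k : k.+1%:R < complex.Re (c - a) -> 1 + a - c + k%:R != 0.
  move=> hk; apply/eqP => /(congr1 (@complex.Re R)) /=.
  have -> : 1 + a - c + k%:R = k.+1%:R - (c - a) by rewrite -natr1; ring.
  by rewrite ReD ReN Re_nat => /eqP; rewrite subr_eq0 => /eqP E; move: hk; rewrite -E ltxx.
elim: e => [|e IH] hca.
  have h := ctends_boundary_term hc hca; have := D0 0 hca; rewrite addr0 => d0.
  have -> : (-1) ^+ 1 * poch a 1 * 0`!%:R / poch (1 + a - c) 1 = (0 - a) * (1 + a - c)^-1.
    by rewrite !pochS !poch0 fact0 expr1 !addr0 !mul1r; ring.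
  apply: ctends_ext (ctendsM (ctendsB h (ctends_cst a)) (ctends_cst (1 + a - c)^-1)) => n.
  have := telescope_poch_ffact a 0 n hc'; rewrite eqxx !mul0r !mulr1 addr0 subr0 => <-.
  by rewrite mulrAC divff // mul1r.
have hca' : e.+1%:R < complex.Re (c - a) by apply: lt_trans hca; rewrite ltr_nat.
have h := ctends_boundary_term hc hca; have d0 := D0 _ hca.
set S := (-1) ^+ e.+1 * poch a e.+1 * e`!%:R / poch (1 + a - c) e.+1 in IH.
have -> : (-1) ^+ e.+2 * poch a e.+2 * (e.+1)`!%:R / poch (1 + a - c) e.+2
    = (0 - e.+1%:R * (a + e.+1%:R) * S) * (1 + a - c + e.+1%:R)^-1.
  rewrite /S (pochS a e.+1) (pochS (1 + a - c) e.+1) factS natrM exprS.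
  move: (poch a e.+1) (poch (1 + a - c) e.+1) (e.+1%:R : R[i]) => p q t.
  by rewrite invfM; ring.
apply: ctends_ext (ctendsM (ctendsB h (ctendsM (ctends_cst _) (IH hca'))) (ctends_cst _)) => n.
have := telescope_poch_ffact a e.+1 n hc'; rewrite /= mulr0 subr0 => <-.
by rewrite mulrAC divff // mul1r.
Qed.

(** Partial sums of the derivative of 2F1(a, b; c; 1) with respect to b at
    b = 0. *)
Definition gauss_log_sum a c n := \sum_(j < n) poch a j.+1 / (poch c j.+1 * j.+1%:R).

(** Since 1/(c)_k - 1/(c+1)_k = k/(c)_(k+1), the factor k cancels. *)
Lemma gauss_log_sum_shift a c n : nonpole c ->
  gauss_log_sum a c n - gauss_log_sum a (c + 1) n
  = c^-1 * \sum_(j < n) poch a j.+1 / poch (c + 1) j.+1 * (j ^_ 0)%:R.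
Proof.
move=> hc; rewrite /gauss_log_sum -sumrB mulr_sumr; apply: eq_bigr => j _.
have hc1 : nonpole (c + 1) := @nonpoleD c 1 hc.
have p0 := poch_neq0 j.+1 hc; have p1 := poch_neq0 j.+1 hc1.
have c0 := nonpoleD_neq0 0 hc; rewrite addr0 in c0.
have j0 : (j.+1%:R : R[i]) != 0 by rewrite pnatr_eq0.
have := poch_shift c j.+1; move: p0 p1; rewrite ffactn0 mulr1.
move: (poch c j.+1) (poch (c + 1) j.+1) (poch a j.+1) => p q s p0 q0 E.
have pE : p = c * q / (c + j.+1%:R) by rewrite E mulfK // nonpoleD_neq0.
have cj := nonpoleD_neq0 j.+1 hc.
by rewrite pE; move: (j.+1%:R : R[i]) j0 cj => t t0 ct; field; rewrite t0 q0 c0 ct.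
Qed.

Lemma ctends_gauss_log_sum_shift a c : nonpole c -> 0 < complex.Re (c - a) ->
  ctends \oo (fun n => gauss_log_sum a c n - gauss_log_sum a (c + 1) n) ((c - a)^-1 - c^-1).
Proof.
move=> hc hca; have hc1 : nonpole (c + 1) := @nonpoleD c 1 hc.
have hca1 : 1%:R < complex.Re (c + 1 - a).
  by rewrite addrAC ReD -[X in _ + complex.Re X]/(1%:R) Re_nat ltrDr.
have c0 := nonpoleD_neq0 0 hc; rewrite addr0 in c0.
have ca0 := nonpoleD_neq0 0 (nonpole_Re_gt0 hca); rewrite addr0 in ca0.
have ac0 : a - c != 0 by rewrite -opprB oppr_eq0.
have -> : (c - a)^-1 - c^-1
    = c^-1 * ((-1) ^+ 1 * poch a 1 * 0`!%:R / poch (1 + a - (c + 1)) 1).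
  rewrite !pochS !poch0 fact0 expr1 !addr0 !mul1r.
  have -> : 1 + a - (c + 1) = a - c by ring.
  by field; rewrite ca0 c0 ac0.
apply: ctends_ext (ctendsM (ctends_cst _) (ctends_sum_poch_ffact hc1 hca1)) => n.
by rewrite gauss_log_sum_shift.
Qed.

Lemma ctends_gauss_log_sum_shiftn a c N : nonpole c -> 0 < complex.Re (c - a) ->
  ctends \oo (fun n => gauss_log_sum a c n - gauss_log_sum a (c + N%:R) n)
    (\sum_(j < N) ((c - a + j%:R)^-1 - (c + j%:R)^-1)).
Proof.
move=> hc hca; elim: N => [|N IH].
  by rewrite big_ord0; apply: ctends_ext (ctends_cst 0) => n; rewrite addr0 subrr.
rewrite big_ord_recr /=.
have hca1 : 0 < complex.Re (c + N%:R - a).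
  by rewrite addrAC ReD Re_nat ltr_wpDr // ler0n.
rewrite [c - a + N%:R]addrAC.
apply: ctends_ext (ctendsD IH (ctends_gauss_log_sum_shift (nonpoleD N hc) hca1)) => n.
by rewrite -(addrA c) natr1 addrA subrK.
Qed.

Lemma normc_poch_le a n : normc (poch a n) <= poch (normc a) n.
Proof.
elim: n => [|n IH]; first by rewrite !poch0 normc1.
rewrite !pochS normcM ler_pM ?normc_ge0 //.
by apply: le_trans (normcD _ _) _; rewrite normc_nat.
Qed.

Lemma poch_Re_le c n : 0 <= complex.Re c -> poch (complex.Re c) n <= normc (poch c n).
Proof.
move=> c0; elim: n => [|n IH]; first by rewrite !poch0 normc1.
have p0 : 0 <= poch (complex.Re c) n by apply: prodr_ge0 => i _; rewrite addr_ge0 ?ler0n.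
rewrite !pochS normcM ler_pM ?addr_ge0 ?ler0n //.
by rewrite -Re_nat -ReD Re_le_normc.
Qed.

(** The real sum with |a| and Re c in place of a and c is a majorant, and it
    telescopes.  The bound is uniform in n and tends to 0 when Re c grows. *)
Lemma gauss_log_sum_le a c n : normc a + 1 < complex.Re c ->
  normc (gauss_log_sum a c n) <= normc a / (complex.Re c - normc a - 1).
Proof.
set x := complex.Re c; set al := normc a => hx.
have al0 : 0 <= al by apply: normc_ge0.
have x0 : 0 < x by lra.
have y0 : 0 < x - al - 1 by lra.
have xj (j : nat) : x + j%:R != 0 by rewrite gt_eqF // ltr_wpDr ?ler0n.
have px k : 0 < poch x k by apply: prodr_gt0 => i _; rewrite ltr_wpDr ?ler0n.
have pa k : 0 <= poch al k by apply: prodr_ge0 => i _; rewrite addr_ge0 ?ler0n.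
apply: le_trans (_ : \sum_(j < n) poch al j.+1 / poch x j.+1 * (j ^_ 0)%:R <= _).
  apply: le_trans (ler_normc_sum n (fun j => poch a j.+1 / (poch c j.+1 * j.+1%:R))) _.
  apply: ler_sum => j _; rewrite ffactn0 mulr1.
  rewrite normcM normcV ler_pM ?normc_ge0 ?invr_ge0 ?normc_ge0 //.
    exact: normc_poch_le.
  have pc := poch_Re_le j.+1 (ltW x0 : 0 <= complex.Re c).
  have pc0 : 0 < normc (poch c j.+1) by apply: lt_le_trans pc; apply: px.
  rewrite normcM normc_nat lef_pV2 ?posrE ?mulr_gt0 ?ltr0n ?px //.
  by apply: le_trans pc _; rewrite ler_peMr ?ler1n // ltW.
rewrite ler_pdivlMr //; have := telescope_poch_ffact al 0 n xj.
rewrite eqxx !mul0r !mulr1 addr0 subr0.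
have : 0 <= poch al n.+1 / poch x n by rewrite divr_ge0 // ltW.
move: (poch al n.+1 / poch x n) (\sum_(_ < _) _) => V S V0 E.
nra.
Qed.

Lemma ctends_psi_sub a c : nonpole a -> nonpole c ->
  ctends \oo (fun n => \sum_(j < n) ((a + j%:R)^-1 - (c + j%:R)^-1)) (psi c - psi a).
Proof.
move=> ha hc; apply: ctends_ext (ctendsB (ctends_psi hc) (ctends_psi ha)) => n.
by rewrite -sumrB; apply: eq_bigr => j _; rewrite /psi_term; ring.
Qed.

(** Shifting c by N leaves a remainder that is small uniformly in n, while
    the sum of the shifts approaches the series of [ctends_psi_sub]. *)
Lemma ctends_gauss_log_sum a c : nonpole c -> 0 < complex.Re (c - a) ->
  ctends \oo (gauss_log_sum a c) (psi c - psi (c - a)).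
Proof.
move=> hc hca; have hp := ctends_psi_sub (nonpole_Re_gt0 hca) hc.
set D := _ - psi _ in hp *.
apply/cvgrPdist_lt => e e0.
have e3 : 0 < e / 3 by rewrite divr_gt0.
have [N [hN1 hN2]] : exists N : nat,
    normc (\sum_(j < N) ((c - a + j%:R)^-1 - (c + j%:R)^-1) - D) < e / 3
    /\ normc a + 1 + normc a / (e / 3) + 1 <= complex.Re c + N%:R.
  near \oo => N; exists N; split.
    have : `|0 - normc (\sum_(j < N) ((c - a + j%:R)^-1 - (c + j%:R)^-1) - D)| < e / 3.
      by near: N; move/cvgrPdist_lt: hp; apply.
    by rewrite sub0r normrN ger0_norm ?normc_ge0.
  rewrite -lerBlDl; near: N; exact: nbhs_infty_ger.
have q0 : 0 <= normc a / (e / 3) by rewrite divr_ge0 ?normc_ge0 // ltW.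
have small n : normc (gauss_log_sum a (c + N%:R) n) < e / 3.
  have hx : normc a + 1 < complex.Re (c + N%:R) by rewrite ReD Re_nat; lra.
  apply: le_lt_trans (gauss_log_sum_le n hx) _.
  rewrite ReD Re_nat ltr_pdivrMr; last by lra.
  rewrite mulrC -ltr_pdivrMr //; lra.
have /cvgrPdist_lt/(_ _ e3) := ctends_gauss_log_sum_shiftn N hc hca.
apply: filterS => n; rewrite !sub0r !normrN !ger0_norm ?normc_ge0 //.
set DN := \sum_(j < N) _ in hN1 *; set X := gauss_log_sum a c n; have := small n.
set Y := gauss_log_sum a _ n => h1 h2.
have -> : X - D = (X - Y - DN) + (Y + (DN - D)) by ring.
apply: le_lt_trans (normcD _ _) _; have := normcD Y (DN - D); lra.
Unshelve. all: by end_near.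
Qed.
End Series.

(** * The coefficients of the expansion in falling factorials *)

Section Coefficients.

Lemma pochD (F : comPzRingType) (x : F) m n : poch x (m + n) = poch x m * poch (x + m%:R) n.
Proof.
elim: n => [|n IH]; first by rewrite addn0 poch0 mulr1.
by rewrite addnS !pochS IH -mulrA -addrA -natrD.
Qed.

Lemma size_pochX (F : idomainType) (x : F) n : (size (poch (x%:P + 'X) n) <= n.+1)%N.
Proof.
elim: n => [|n IH]; first by rewrite poch0 size_poly1.
rewrite pochS; apply: leq_trans (size_polyMleq _ _) _.
have -> : x%:P + 'X + n%:R = 'X + (x + n%:R)%:P :> {poly F}.
  by rewrite polyCD polyC_natr; ring.
by rewrite size_XaddC addn2 /= ltnS.
Qed.

Lemma size_prod_le_sum (F : idomainType) r (p : 'I_r -> {poly F}) (m : 'I_r -> nat) :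
  (forall i, (size (p i) <= (m i).+1)%N) ->
  (size (\prod_(i < r) p i)%R <= (\sum_(i < r) m i).+1)%N.
Proof.
move=> h; elim/big_rec2: _ => [|i n q _ hq]; first by rewrite size_poly1.
apply: leq_trans (size_polyMleq _ _) _.
rewrite -subn1 leq_subLR; apply: leq_trans (leq_add (h i) hq) _.
by rewrite addSn addnS add1n.
Qed.

Lemma horner_poch (F : comNzRingType) (x y : F) n : (poch (x%:P + 'X) n).[y] = poch (x + y) n.
Proof.
rewrite horner_prod; apply: eq_bigr => i _.
by rewrite !hornerE -polyC_natr hornerC.
Qed.

Variables (R : realType) (r : nat) (m : 'I_r -> nat) (d : 'I_r -> R[i]).
Hypothesis hd : forall i, nonpole (d i).

Lemma sum_sigma (x : R[i]) :
  \prod_(i < r) poch (d i + x) (m i) = \sum_(j < (mtot m).+1) sigma m d j * x ^+ j.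
Proof.
rewrite /sigma -horner_coef_wide; last by apply: size_prod_le_sum => i; apply: size_pochX.
by rewrite horner_prod; apply: eq_bigr => i _; rewrite horner_poch.
Qed.

Lemma Lambda_neq0 : Lambda m d != 0.
Proof. by apply/prodf_neq0 => i _; apply: poch_neq0. Qed.

(** Factor by factor, (d)_k (d + k)_m = (d)_(k+m) = (d)_m (d + m)_k. *)
Lemma prod_poch_ratio k :
  \prod_(i < r) poch (d i + (m i)%:R) k / \prod_(i < r) poch (d i) k
  = (Lambda m d)^-1 * \prod_(i < r) poch (d i + k%:R) (m i).
Proof.
have p0 : \prod_(i < r) poch (d i) k != 0 by apply/prodf_neq0 => i _; apply: poch_neq0.
apply: (mulfI Lambda_neq0); rewrite mulrA (mulVKf Lambda_neq0).
apply: (mulIf p0); rewrite divfK // /Lambda -!big_split /=; apply: eq_bigr => i _.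
by rewrite -pochD mulrC -pochD addnC.
Qed.

(** The powers of k in [sum_sigma] are expanded by [expn_sum_stirling2], and
    the double sum is reordered. *)
Lemma Ccoef_ffact k :
  \prod_(i < r) poch (d i + (m i)%:R) k / \prod_(i < r) poch (d i) k
  = \sum_(l < (mtot m).+1) Ccoef m d l * (k ^_ l)%:R.
Proof.
rewrite prod_poch_ratio sum_sigma /Ccoef.
under [RHS]eq_bigr => l _ do rewrite -mulrA.
rewrite -mulr_sumr; congr (_ * _).
under [RHS]eq_bigr => l _ do rewrite big_geq_mkord mulr_suml.
rewrite (exchange_big_dep predT) //=; apply: eq_bigr => j _.
rewrite -natrX expn_sum_stirling2 natr_sum mulr_sumr.
rewrite (big_ord_widen _ (fun l => sigma m d j * (stirling2 j l * k ^_ l)%:R) (ltn_ord j)).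
by apply: eq_big => [l|l _]; rewrite ?ltnS // natrM mulrA.
Qed.

Lemma Ccoef0 : Ccoef m d 0 = 1.
Proof.
have p0 (x : 'I_r -> R[i]) : \prod_(i < r) poch (x i) 0 = 1.
  by apply: big1 => i _; rewrite poch0.
have := Ccoef_ffact 0; rewrite !p0 divr1.
rewrite big_ord_recl big1 => [|l _]; last by rewrite ffact0n mulr0.
by rewrite ffactn0 mulr1 addr0.
Qed.
End Coefficients.

(** * Summation of the series *)

Theorem theorem4 (R : realType) (r : nat) (hr : (1 <= r)%N)
    (m : 'I_r -> nat) (hm : forall i, (0 < m i)%N)
    (a c : R[i]) (d : 'I_r -> R[i])
    (hc : forall n : nat, c != - n%:R)
    (hd : forall (i : 'I_r) (n : nat), d i != - n%:R)
    (hca : (mtot m)%:R < complex.Re (c - a)) :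
  (\sum_(1 <= k < n.+1)
      (poch a k * \prod_(i < r) poch (d i + (m i)%:R) k)
      / (poch c k * (\prod_(i < r) poch (d i) k) * k%:R) : R[i]^o) @[n --> \oo]
  --> (psi c - psi (c - a)
       + \sum_(1 <= k < (mtot m).+1)
           ((-1) ^+ k * poch a k * Gamma (k%:R : R[i]) * Ccoef m d k)
           / poch (1 + a - c) k : R[i]^o).
Proof.
have hca0 : 0 < complex.Re (c - a) by apply: le_lt_trans hca; rewrite ler0n.
have H : ctends \oo (fun n => \sum_(1 <= k < n.+1)
      (poch a k * \prod_(i < r) poch (d i + (m i)%:R) k)
      / (poch c k * (\prod_(i < r) poch (d i) k) * k%:R))
    (psi c - psi (c - a) + \sum_(1 <= k < (mtot m).+1)
           ((-1) ^+ k * poch a k * Gamma (k%:R : R[i]) * Ccoef m d k)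
           / poch (1 + a - c) k).
  (* From here on, k = l + 1 in the finite sum and k = j + 1 in the series. *)
  rewrite big_add1 /= big_mkord.
  pose S l n := \sum_(j < n) poch a j.+1 / poch c j.+1 * (j ^_ l)%:R.
  pose V l := (-1) ^+ l.+1 * poch a l.+1 * l`!%:R / poch (1 + a - c) l.+1.
  have SV : ctends \oo (fun n => \sum_(l < mtot m) Ccoef m d l.+1 * S l n)
     (\sum_(l < mtot m) Ccoef m d l.+1 * V l).
    apply: (ctends_sum (u := fun l n => Ccoef m d l.+1 * S l n)
       (l := fun l => Ccoef m d l.+1 * V l)) => l hl.
    apply: ctendsM; first exact: ctends_cst.
    by apply: ctends_sum_poch_ffact => //; apply: le_lt_trans hca; rewrite ler_nat.
  have -> : \sum_(l < mtot m) ((-1) ^+ l.+1 * poch a l.+1 * Gamma (l.+1%:R : R[i]) * Ccoef m d l.+1)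
           / poch (1 + a - c) l.+1 = \sum_(l < mtot m) Ccoef m d l.+1 * V l.
    by apply: eq_bigr => l _; rewrite /V Gamma_nat; ring.
  apply: ctends_ext (ctendsD (ctends_gauss_log_sum hc hca0) SV) => n.
  rewrite big_add1 /= big_mkord /gauss_log_sum /S.
  under eq_bigr => l _ do rewrite mulr_sumr.
  rewrite exchange_big /= -big_split /=; apply: eq_bigr => j _.
  have -> : poch a j.+1 * \prod_(i < r) poch (d i + (m i)%:R) j.+1
      / (poch c j.+1 * (\prod_(i < r) poch (d i) j.+1) * j.+1%:R)
    = poch a j.+1 / poch c j.+1 * (j.+1%:R^-1 *
      (\prod_(i < r) poch (d i + (m i)%:R) j.+1 / \prod_(i < r) poch (d i) j.+1)).
    by rewrite !invfM; ring.
  (* The term l = 0, with coefficient 1, is the logarithmic series; in the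
     others 1/(j+1) cancels the first factor of (j+1)^_(l+1). *)
  rewrite (Ccoef_ffact _ hd) big_ord_recl Ccoef0 // ffactn0 mulr1 mulrDr mulr1 mulrDr invfM.
  rewrite mulrA; congr (_ + _); rewrite !mulr_sumr; apply: eq_bigr => l _.
  have j0 : (j.+1%:R : R[i]) != 0 by rewrite pnatr_eq0.
  by rewrite lift0 ffactSS natrM [X in _ = _ * (_ * X)]mulrCA (mulKf j0) mulrCA.
move/ctendsP : H => H.
exact: H.
Qed.
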